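(* Let $X$ be the toric variety of Picard rank two with weight matrix \[ \begin{pmatrix} a_1&a_2&a_3&\cdots&a_N\\ b_1&b_2&b_3&\cdots&b_N\end{pmatrix}, \] so that $\dim X=N-2$ (see the context for the conditions imposed on the weight matrix). Let $a=a_1+\cdots+a_N$, $b=b_1+\cdots+b_N$, and $\ell=\gcd\{a,b\}$. Let $[\mu:\nu]\in\mathbb{P}^1$ be the unique root of the homogeneous polynomial \[ \prod_{i=1}^N(a_i\mu+b_i\nu)^{a_ib}-\prod_{i=1}^N(a_i\mu+b_i\nu)^{b_ia} \] such that $a_i\mu+b_i\nu\ge 0$ for all $i\in\{1,2,\ldots,N\}$, and set \[ p_i=\frac{\mu a_i+\nu b_i}{\mu a+\nu b}. \] Let $c_d$ denote the coefficient of $t^d$ in the regularized quantum period of $X$, \[ \widehat{G}_X(t)=\sum_{(k,l)\in\mathbb{Z}^2\cap C}\frac{(ak+bl)!}{(a_1k+b_1l)!\cdots(a_Nk+b_Nl)!}\,t^{ak+bl}, \] where $C=\{(x,y)\in\mathbb{R}^2 \mid a_ix+b_iy\ge 0 \text{ for all } i\in\{1,\ldots,N\}\}$. Then the non-zero coefficients $c_d$ satisfy \[ \log c_d\sim Ad-\frac{\dim X}{2}\log d+B \] as $d\to\infty$, where \[ A=-\sum_{i=1}^Np_i\log p_i, \] \[ B=-\frac{\dim X}{2}\log(2\pi)-\frac12\sum_{i=1}^N\log p_i-\frac12\log\left(\sum_{i=1}^N\frac{(a_ib-b_ia)^2}{\ell^2p_i}\right). \]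
   Context: Toric varieties of Picard rank two. One is given a $2\times N$ matrix with columns $(a_i,b_i)$, $i=1,\ldots,N$, with non-negative integer entries and no zero columns. It defines an action of $\mathbb{C}^\times\times\mathbb{C}^\times$ on $\mathbb{C}^N$ in which $(s,t)$ sends $(x_1,\ldots,x_N)$ to $(s^{a_1}t^{b_1}x_1,\ldots,s^{a_N}t^{b_N}x_N)$. Set $a=\sum_i a_i$, $b=\sum_i b_i$, and assume that $(a,b)$ is not a scalar multiple of $(a_i,b_i)$ for any $i$. Define linear subspaces of $\mathbb{C}^N$ by \[ S_+=\{x \mid x_i=0\text{ if } b_i/a_i<b/a\},\qquad S_-=\{x\mid x_i=0\text{ if } b_i/a_i>b/a\} \] (with $b_i/a_i=+\infty$ if $a_i=0$), and assume that $S_+$ and $S_-$ both have dimension at least two. Then $X=(\mathbb{C}^N\setminus(S_+\cup S_-))/(\mathbb{C}^\times\times\mathbb{C}^\times)$ is the toric variety of Picard rank two with the given weight matrix; it has dimension $N-2$. The regularized quantum period of $X$ is a generating function of Gromov--Witten invariants of $X$; for these varieties it is given by the closed formula displayed in the claim, which may be taken as its definition here. The inequalities $a_i\mu+b_i\nu\ge0$ are understood for a suitable real representative $(\mu,\nu)$ of $[\mu:\nu]$, i.e. $(\mu,\nu)\in C$. The relation $\log c_d\sim Ad-\frac{\dim X}{2}\log d+B$ means that the difference of the two sides tends to $0$ as $d\to\infty$ through those $d$ with $c_d\ne0$. $\log$ is the natural logarithm.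
   Formalization: The root [μ:ν] is taken with a_iμ+b_iν>0 for all i, since with ≥0 it need not be unique (columns (1,1),(1,1),(1,2),(1,2)) and log p_i may be undefined; uniqueness with ≥0 is proved when some a_i=0 and some b_j=0. *)

(* Defs.v *)
From mathcomp Require Import all_boot all_order all_algebra.
From mathcomp Require Import all_classical all_reals all_analysis.
From mathcomp Require Import complex.

Set Implicit Arguments.
Unset Strict Implicit.
Unset Printing Implicit Defensive.

Import Order.TTheory GRing.Theory Num.Theory.
Import numFieldNormedType.Exports.

Local Open Scope classical_set_scope.
Local Open Scope ring_scope.

(* The columns of the 2 x N weight matrix are (a i, b i) for i in 'I_N. *)

Definition weight_sum (N : nat) (w : 'I_N -> nat) : nat := (\sum_(i < N) w i)%N.

(* The slope y / x of the vector (x, y), with value +oo when x = 0. *)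
Definition weight_slope (R : realType) (x y : nat) : \bar R :=
  if x == 0%N then +oo%E else (y%:R / x%:R)%:E.

Section Subspaces.
Variables (R : realType) (N : nat).

(* Row vectors of C^N with i-th coordinate 0, as the kernel of the projection
   [col i]. *)
Definition coord_hyperplane (i : 'I_N) : {vspace 'rV[R[i]]_N} :=
  lker (linfun (@col R[i] 1 N i)).

Definition S_plus (a b : 'I_N -> nat) : {vspace 'rV[R[i]]_N} :=
  (\bigcap_(i < N | (weight_slope R (a i) (b i) <
       weight_slope R (weight_sum a) (weight_sum b))%E)
     coord_hyperplane i)%VS.

Definition S_minus (a b : 'I_N -> nat) : {vspace 'rV[R[i]]_N} :=
  (\bigcap_(i < N | (weight_slope R (weight_sum a) (weight_sum b) <
       weight_slope R (a i) (b i))%E)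
     coord_hyperplane i)%VS.

Lemma mem_coord_hyperplane (i : 'I_N) (x : 'rV[R[i]]_N) :
  (x \in coord_hyperplane i) = (x 0 i == 0).
Proof.
rewrite memv_ker lfunE /=; apply/eqP/eqP => [/matrixP/(_ 0 0)|xi0].
  by rewrite !mxE.
by apply/matrixP => j k; rewrite !mxE (ord1 j).
Qed.

Lemma S_plusP (a b : 'I_N -> nat) (x : 'rV[R[i]]_N) :
  (x \in S_plus a b) <->
  (forall i, (weight_slope R (a i) (b i) <
       weight_slope R (weight_sum a) (weight_sum b))%E ->
    x 0 i = 0).
Proof.
rewrite memvE; split=> [/subv_bigcapP xS i ai|xS].
  by apply/eqP; rewrite -mem_coord_hyperplane memvE xS.
by apply/subv_bigcapP => i ai; rewrite -memvE mem_coord_hyperplane xS.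
Qed.

Lemma S_minusP (a b : 'I_N -> nat) (x : 'rV[R[i]]_N) :
  (x \in S_minus a b) <->
  (forall i, (weight_slope R (weight_sum a) (weight_sum b) <
       weight_slope R (a i) (b i))%E ->
    x 0 i = 0).
Proof.
rewrite memvE; split=> [/subv_bigcapP xS i ai|xS].
  by apply/eqP; rewrite -mem_coord_hyperplane memvE xS.
by apply/subv_bigcapP => i ai; rewrite -memvE mem_coord_hyperplane xS.
Qed.

End Subspaces.

Record toric_weights (R : realType) (N : nat) (a b : 'I_N -> nat) : Prop := {
  no_zero_column : forall i, ~ (a i = 0%N /\ b i = 0%N);
  not_scalar_multiple : forall i,
    ~ exists c : R, (weight_sum a)%:R = c * (a i)%:R /\
                   (weight_sum b)%:R = c * (b i)%:R;
  dim_S_plus : (2 <= \dim (S_plus R a b))%N;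
  dim_S_minus : (2 <= \dim (S_minus R a b))%N
}.

(* dim X. No truncation occurs: the hypotheses on the weights force N >= 4. *)
Definition dimX (N : nat) : nat := (N - 2)%N.

Section QuantumPeriod.
Variables (R : realType) (N : nat) (a b : 'I_N -> nat).

Definition weight_form (x y : R) (i : 'I_N) : R := (a i)%:R * x + (b i)%:R * y.

Definition weight_cone : set (R * R) :=
  [set xy | forall i, 0 <= weight_form xy.1 xy.2 i].

Definition root_poly (x y : R) : R :=
  \prod_(i < N) weight_form x y i ^+ (a i * weight_sum b) -
  \prod_(i < N) weight_form x y i ^+ (b i * weight_sum a).

(* (mu, nu) are homogeneous coordinates of a point of the projective line,
   chosen in the cone, at which the homogeneous polynomial vanishes. *)
Definition root_in_cone (mu nu : R) : Prop :=
  [/\ (mu, nu) <> (0, 0), root_poly mu nu = 0 & weight_cone (mu, nu)].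

Definition same_point (mu nu mu' nu' : R) : Prop := mu * nu' = mu' * nu.

Definition root_p (mu nu : R) (i : 'I_N) : R :=
  (mu * (a i)%:R + nu * (b i)%:R) /
  (mu * (weight_sum a)%:R + nu * (weight_sum b)%:R).

(* The lattice points of the cone that contribute to t^d. Under
   [toric_weights] the cone is pointed and (x, y) |-> a x + b y is positive on
   its nonzero points, so this set is finite. *)
Definition lattice_points (d : nat) : set (int * int) :=
  [set kl | weight_cone (kl.1%:~R, kl.2%:~R) /\
            (weight_sum a)%:Z * kl.1 + (weight_sum b)%:Z * kl.2 = d%:Z].

(* On lattice points of the cone the arguments of [absz] are nonnegative. *)
Definition multinomial_term (kl : int * int) : R :=
  (absz ((weight_sum a)%:Z * kl.1 + (weight_sum b)%:Z * kl.2))`!%:R /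
  \prod_(i < N) (absz ((a i)%:Z * kl.1 + (b i)%:Z * kl.2))`!%:R.

Definition period_coef (d : nat) : R :=
  \sum_(kl \in lattice_points d) multinomial_term kl.

Definition growthA (mu nu : R) : R :=
  - \sum_(i < N) root_p mu nu i * ln (root_p mu nu i).

Definition growthB (mu nu : R) : R :=
  - ((dimX N)%:R / 2 * ln (2 * pi))
  - 2^-1 * (\sum_(i < N) ln (root_p mu nu i))
  - 2^-1 * ln (\sum_(i < N)
      ((a i)%:R * (weight_sum b)%:R - (b i)%:R * (weight_sum a)%:R) ^+ 2 /
      ((gcdn (weight_sum a) (weight_sum b))%:R ^+ 2 * root_p mu nu i)).

End QuantumPeriod.

(* Main.v *)
Require Import Defs.
From mathcomp Require Import all_boot all_order all_algebra.
From mathcomp Require Import all_classical all_reals all_analysis.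
From mathcomp Require Import measurable_realfun zify ring lra.

(** On the line a x + b y = d the lattice points are (k, l) + j (b, - a) / gcd(a, b),
    so c_d is a sum over j of multinomial coefficients whose entries
    n_i = p_i d + (j - c) w_i move linearly, with \sum w_i = 0. Since (mu, nu) is a
    root, \sum w_i log p_i = 0, and every summand is therefore e^(A d) times a
    product of Poisson weights of means p_i d, up to a factor that depends on d only.
    Rescaling j by sqrt d turns the sum into the integral of a step function that
    converges pointwise to a Gaussian of variance 1 / \sum (w_i ^ 2 / p_i) and is
    dominated by another Gaussian: dominated convergence gives the asymptotics up to
    the constant in Stirling's formula. The case N = 2, p = (1/2, 1/2), in which the
    sum is 2 ^ d, then determines that constant.

    Along the line a x + b y = 1 the logarithm of the quotient of the two products
    in the root equation is strictly monotone, and it is infinite at the two ends of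
    the cone: this gives the existence and uniqueness of the root. *)

Set Implicit Arguments.
Unset Strict Implicit.
Unset Printing Implicit Defensive.
Import Order.TTheory GRing.Theory Num.Theory.
Import numFieldNormedType.Exports.
Local Open Scope classical_set_scope.
Local Open Scope ring_scope.

(** * Bounds for the logarithm and the relative entropy *)

Lemma MVT_pos (R : realType) (f df : R -> R) (x y : R) :
    (forall z : R, 0 < z -> is_derive z 1 f (df z)) -> 0 < x -> 0 < y ->
  exists2 z, Num.min x y <= z <= Num.max x y & f y - f x = df z * (y - x).
Proof.
move=> f_df.
wlog xy : x y / x <= y => [hw x0 y0|x0 y0].
  have /orP[/hw|yx] := le_total x y; first exact.
  have [z zxy e] := hw _ _ yx y0 x0; exists z; first by rewrite minC maxC.
  by rewrite -opprB e -mulrN opprB.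
have df_pos z : z \in `[x, y] -> is_derive z 1 f (df z).
  by rewrite in_itv /= => /andP[xz _]; apply: f_df; exact: lt_le_trans xz.
have [z zxy e] : exists2 z, z \in `[x, y] & f y - f x = df z * (y - x).
  refine (MVT_segment xy (fun z zxy => df_pos z (subset_itv_oo_cc zxy)) _).
  apply: derivable_within_continuous => z zxy.
  by have [] := df_pos z zxy.
by exists z => //; move: zxy; rewrite in_itv /= (min_idPl xy) (max_idPr xy).
Qed.

(** The difference of the two sides has derivative (z - 1)^2 / (z (z + 1)^2). At y = (n + 1) / n the
    bound is 1 / (n + 1/2), which makes [stirling_gap] decrease. *)
Lemma ln_ge_rational (R : realType) (y : R) : 1 <= y ->
  2 * (y - 1) / (y + 1) <= ln y.
Proof.
move=> y1.
have [|//||z zy] := @MVT_pos R (fun z => ln z + 4 * (z + 1)^-1)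
  (fun z => z^-1 - 4 * (z + 1) ^- 2) 1 y.
- move=> z z0; have z1 : z + 1 != 0 by lra.
  have dln := is_derive1_ln z0.
  have dD : is_derive z 1 (fun u : R => u + 1) 1.
    by apply: is_derive_eq; rewrite addr0.
  have dV : is_derive z 1 (fun u : R => (u + 1)^-1) _ :=
    @is_deriveV R (fun u => u + 1) z 1 1 z1 dD.
  apply: is_derive_eq.
  rewrite /GRing.scale /= ; field.
  by rewrite z1 gt_eqF.
- by lra.
move: zy; rewrite (min_idPl y1) (max_idPr y1) => /andP[z1 _].
rewrite ln1 => e.
have z0 : 0 < z by lra.
have : 0 <= (z^-1 - 4 * (z + 1) ^- 2) * (y - 1).
  apply: mulr_ge0; last lra.
  have -> : z^-1 - 4 * (z + 1) ^- 2 = (z - 1) ^+ 2 / (z * (z + 1) ^+ 2).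
    by field; rewrite !gt_eqF //; lra.
  by apply: divr_ge0; rewrite ?sqr_ge0 // mulr_ge0 ?sqr_ge0 ?ltW.
rewrite -e => h.
have -> : 2 * (y - 1) / (y + 1) = 2 - 4 * (y + 1)^-1.
  by field; rewrite gt_eqF //; lra.
have : 4 * (1 + 1 : R)^-1 = 2 by field.
lra.
Qed.

(** The difference has derivative (1 - 1/z)^2 / 2. At y = (n + 1) / n, multiplication by n + 1/2
    gives 1 + 1/(4n) - 1/(4(n + 1)), a telescoping bound. *)
Lemma ln_le_rational (R : realType) (y : R) : 1 <= y -> ln y <= (y - y^-1) / 2.
Proof.
move=> y1.
have [|//||z zy] := @MVT_pos R (fun z => (z - z^-1) / 2 - ln z)
  (fun z => (1 - z^-1) ^+ 2 / 2) 1 y.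
- move=> z z0; have z1 : z != 0 by lra.
  have dln := is_derive1_ln z0.
  have dV : is_derive z 1 (fun u : R => u^-1) _ :=
    @is_deriveV R id z 1 1 z1 (is_derive_id _ _).
  apply: is_derive_eq.
  rewrite !scaler0 /GRing.scale /= ; field.
  by [].
- by lra.
rewrite ln1 invr1 => e.
have : 0 <= (1 - z^-1) ^+ 2 / 2 * (y - 1).
  by rewrite mulr_ge0 ?divr_ge0 ?sqr_ge0 //; lra.
rewrite -e; lra.
Qed.

(* The second derivative of [q |-> q * ln (q / p)] is [1 / q >= 1]. *)
Lemma rel_entropy_ge (R : realType) (p q : R) : 0 < p <= 1 -> 0 <= q <= 1 ->
  (q - p) ^+ 2 / 2 <= q * (ln q - ln p) - q + p.
Proof.
move=> /andP[p0 p1] /andP[]; rewrite le_eqVlt => /predU1P[<- _|q0 q1].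
  by rewrite mul0r; nra.
have [|//|//|z zpq e] := @MVT_pos R
  (fun q => q * (ln q - ln p) - q + p - (q - p) ^+ 2 / 2)
  (fun q => ln q - ln p - (q - p)) p q.
  move=> z z0; have z1 : z != 0 by lra.
  have dln := is_derive1_ln z0.
  apply: is_derive_eq.
  rewrite !scaler0 /GRing.scale /= ; field.
  by [].
(* The derivative has the sign of [q - p], because [ln] has slope at least 1 on (0, 1]. *)
suff : 0 <= (ln z - ln p - (z - p)) * (q - p) by rewrite -e; nra.
have ln_sub (x y : R) : 0 < x -> x <= y -> y <= 1 -> y - x <= ln y - ln x.
  move=> x0 xy y1; have y0 : 0 < y by lra.
  have : ln (x / y) <= x / y - 1.
    have {1}-> : x / y = 1 + (x / y - 1) by ring.
    by apply: le_ln1Dx; have := divr_gt0 x0 y0; lra.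
  rewrite ln_div ?posrE //.
  have : y - x <= (y - x) / y by rewrite ler_pdivlMr //; nra.
  have -> : (y - x) / y = 1 - x / y by field; rewrite gt_eqF.
  lra.
move: zpq; have [pq|/ltW qp] := leP p q => /andP[h1 h2].
  have := ln_sub p z p0 h1 ltac:(lra); move=> ?; apply: mulr_ge0; lra.
have := ln_sub z p ltac:(lra) h2 p1; move=> ?; apply: mulr_le0; lra.
Qed.

(** The derivative [ln z - (z - 1)] is at most (z - 1)^2 / z in absolute value, hence at most 2 x^2
    since z >= 1/2; the mean value theorem supplies the third factor of x. *)
Lemma rel_entropy_taylor (R : realType) (x : R) : `|x| <= 2^-1 ->
  `|(1 + x) * ln (1 + x) - x - x ^+ 2 / 2| <= 2 * `|x| ^+ 3.
Proof.
move=> hx; have /andP[x1 x2] : - 2^-1 <= x <= 2^-1 by rewrite -ler_norml.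
have [|//||z zxy] := @MVT_pos R
  (fun y => y * ln y - (y - 1) - (y - 1) ^+ 2 / 2)
  (fun y => ln y - (y - 1)) 1 (1 + x).
- move=> z z0; have z1 : z != 0 by lra.
  have dln := is_derive1_ln z0.
  apply: is_derive_eq.
  rewrite !scaler0 /GRing.scale /= ; field.
  by [].
- by lra.
rewrite ln1 => e.
have -> : (1 + x) * ln (1 + x) - x - x ^+ 2 / 2 = (ln z - (z - 1)) * x.
  lra.
have [z0 zx] : 2^-1 <= z /\ `|z - 1| <= `|x|.
  move: zxy; have [h|/ltW h] := leP 1 (1 + x) => /andP[h1 h2].
    by split; [lra|rewrite !ger0_norm; lra].
  by split; [lra|rewrite !ler0_norm; lra].
rewrite normrM exprS mulrCA mulrC; apply: ler_wpM2l => //.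
have -> : `|x| ^+ 2 = x ^+ 2 by rewrite real_normK ?num_real.
have zx2 : (z - 1) ^+ 2 <= x ^+ 2.
  by rewrite -[(z - 1) ^+ 2]real_normK ?num_real // -[x ^+ 2]real_normK ?num_real //
    ler_sqr ?nnegrE.
have lnz1 : ln z <= z - 1.
  have {1}-> : z = 1 + (z - 1) by ring.
  by apply: le_ln1Dx; lra.
have lnz2 : ln z^-1 <= z^-1 - 1.
  have {1}-> : z^-1 = 1 + (z^-1 - 1) by ring.
  have : 0 < z^-1 by rewrite invr_gt0; lra.
  by move=> zV; apply: le_ln1Dx; lra.
move: lnz2; rewrite lnV ?posrE; last by lra.
move=> lnz2.
have : z^-1 - 1 + (z - 1) <= 2 * (z - 1) ^+ 2.
  have -> : z^-1 - 1 + (z - 1) = (z - 1) ^+ 2 / z.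
    by field; rewrite gt_eqF //; lra.
  rewrite mulrC ler_wpM2r ?sqr_ge0 //.
  by rewrite invf_ple ?posrE //; lra.
by rewrite ler0_norm; lra.
Qed.

(** * Stirling's formula up to its constant *)

(** For n > 0, the logarithm of n! / (sqrt n (n / e)^n). *)
Definition stirling_gap (R : realType) (n : nat) : R :=
  ln (n`!%:R) - ((n%:R + 2^-1) * ln n%:R - n%:R).

Lemma stirling_gap_step (R : realType) (n : nat) : (0 < n)%N ->
  0 <= stirling_gap R n - stirling_gap R n.+1 <=
  (4 * n%:R)^-1 - (4 * n.+1%:R)^-1.
Proof.
move=> n0.
have N0 : 0 < n%:R :> R by rewrite ltr0n.
set x : R := n%:R in N0 *.
have xS : n.+1%:R = x + 1 :> R by rewrite -natr1.
pose y := (x + 1) / x.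
have y1 : 1 <= y by rewrite /y ler_pdivlMr // mul1r; lra.
have lny : ln y = ln (x + 1) - ln x by rewrite ln_div ?posrE //; lra.
have -> : stirling_gap R n - stirling_gap R n.+1 = (x + 2^-1) * ln y - 1.
  rewrite /stirling_gap factS natrM lnM ?posrE ?ltr0n ?fact_gt0 //.
  by rewrite xS -/x lny; field.
have x12 : 0 <= x + 2^-1 by lra.
apply/andP; split.
- have := ler_wpM2l x12 (ln_ge_rational y1).
  have -> : (x + 2^-1) * (2 * (y - 1) / (y + 1)) = 1.
    by rewrite /y; field; rewrite !gt_eqF //; lra.
  lra.
- have := ler_wpM2l x12 (ln_le_rational y1).
  have -> : (x + 2^-1) * ((y - y^-1) / 2) = 1 + ((4 * x)^-1 - (4 * n.+1%:R)^-1).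
    by rewrite /y xS; field; rewrite !gt_eqF //; lra.
  by rewrite lerBlDl.
Qed.

Lemma stirling_gap1 (R : realType) : stirling_gap R 1 = 1.
Proof. by rewrite /stirling_gap ln1; lra. Qed.

Lemma stirling_gap_bounds (R : realType) (n : nat) : (0 < n)%N ->
  0 <= stirling_gap R n <= 1.
Proof.
move=> n0.
(* The term 1/(4n) makes the lower bound inductive: from n to n + 1 it drops by exactly the largest
   loss that [stirling_gap_step] allows. *)
suff : 2^-1 + (4 * n%:R)^-1 <= stirling_gap R n <= 1.
  move=> /andP[h ->]; rewrite andbT; apply: le_trans h.
  by rewrite addr_ge0 // invr_ge0 mulr_ge0.
elim: n n0 => // -[_ _|n IH _]; first by rewrite stirling_gap1; apply/andP; split; lra.
have := @stirling_gap_step R n.+1 isT; have := IH isT.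
move: (4 * n.+1%:R)^-1 (4 * n.+2%:R)^-1 => u v.
by move=> /andP[? ?] /andP[? ?]; apply/andP; split; lra.
Qed.

Lemma cvg_stirling_gap (R : realType) : cvgn (stirling_gap R).
Proof.
suff : cvgn (fun n => stirling_gap R n.+1).
  by move=> /cvg_ex[l]; rewrite cvg_shiftS => ?; apply/cvg_ex; exists l.
apply: nonincreasing_is_cvgn.
  apply/nonincreasing_seqP => n.
  by have /andP[] := @stirling_gap_step R n.+1 isT; rewrite subr_ge0.
exists 0 => _ [n _ <-].
by have /andP[] := @stirling_gap_bounds R n.+1 isT.
Qed.

(** * Poisson weights: Gaussian bound and local limit *)

(** The Poisson weight at [n] for the mean [p * D]. The factor sqrt D gives it a positive limit at
    distances of order sqrt D from the mean. *)
Definition scaled_poisson (R : realType) (p : R) (D n : nat) : R :=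
  Num.sqrt D%:R * ((p * D%:R) ^+ n * expR (- (p * D%:R)) / n`!%:R).

Lemma scaled_poisson_gt0 (R : realType) (p : R) (D n : nat) :
  0 < p -> (0 < D)%N -> 0 < scaled_poisson p D n.
Proof.
move=> p0 D0; have N0 : 0 < D%:R :> R by rewrite ltr0n.
by rewrite mulr_gt0 ?sqrtr_gt0 ?divr_gt0 ?mulr_gt0 ?exprn_gt0 ?mulr_gt0
  ?expR_gt0 ?ltr0n ?fact_gt0.
Qed.

Lemma ln_sqrtr (R : realType) (x : R) : 0 < x -> ln (Num.sqrt x) = ln x / 2.
Proof.
move=> x0; have := congr1 (@ln R) (sqr_sqrtr (ltW x0)).
by rewrite lnXn ?sqrtr_gt0 // => <-; rewrite -[_ *+ 2]mulr_natr; field.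
Qed.

(** Writing n! through [stirling_gap] leaves D times the relative entropy of [q] with respect to
    [p]; the term [ln q / 2] comes from sqrt (D / n). *)
Lemma scaled_poissonE (R : realType) (p : R) (D n : nat) :
    0 < p -> (0 < D)%N -> (0 < n)%N ->
  let q := n%:R / D%:R in
  scaled_poisson p D n = expR (- stirling_gap R n - ln q / 2
    - D%:R * (q * (ln q - ln p) - q + p)).
Proof.
move=> p0 D0 n0 q.
have N0 : 0 < D%:R :> R by rewrite ltr0n.
have M0 : 0 < n%:R :> R by rewrite ltr0n.
have pN0 : 0 < p * D%:R by rewrite mulr_gt0.
have F0 : 0 < n`!%:R :> R by rewrite ltr0n fact_gt0.
rewrite -[LHS]lnK ?posrE ?scaled_poisson_gt0 //; congr expR.
rewrite /scaled_poisson lnM ?posrE ?sqrtr_gt0 //; last first.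
  by rewrite divr_gt0 // mulr_gt0 ?exprn_gt0 ?expR_gt0.
rewrite ln_div ?posrE ?mulr_gt0 ?exprn_gt0 ?expR_gt0 //.
rewrite lnM ?posrE ?exprn_gt0 ?expR_gt0 // expRK lnXn // lnM ?posrE //.
rewrite ln_sqrtr // /q ln_div ?posrE // /stirling_gap -[_ *+ n]mulr_natr.
by field; rewrite gt_eqF.
Qed.

(** A bound uniform in [n] and [D], to serve in dominated convergence. The relative entropy gives a
    Gaussian with twice this exponent; half of it is spent on the prefactor sqrt (D / n), which is
    large for small [n]. *)
Lemma scaled_poisson_le (R : realType) (p : R) (D n : nat) :
    0 < p <= 1 -> (0 < D)%N -> (n <= D)%N ->
  scaled_poisson p D n <=
  16 / p ^+ 2 * expR (- ((n%:R - p * D%:R) ^+ 2 / (4 * D%:R))).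
Proof.
move=> /andP[p0 p1] D0 nD.
have N1 : 1 <= D%:R :> R by rewrite ler1n.
have N0 : 0 < D%:R :> R by rewrite ltr0n.
pose q : R := n%:R / D%:R.
have q0 : 0 <= q by rewrite divr_ge0.
have q1 : q <= 1 by rewrite ler_pdivrMr // mul1r ler_nat.
have sqrt_le (x : R) : 1 <= x -> Num.sqrt x <= x.
  move=> x1; rewrite -[leRHS]sqr_sqrtr; last by lra.
  have : 1 <= Num.sqrt x by rewrite -[leLHS]sqrtr1 ler_sqrt //; lra.
  by move=> h; rewrite expr2 ler_pMr // (lt_le_trans ltr01).
have G := @rel_entropy_ge R p q ltac:(lra) ltac:(lra).
pose E := expR (- (D%:R * (q - p) ^+ 2 / 4)).
have -> : (n%:R - p * D%:R) ^+ 2 / (4 * D%:R) = D%:R * (q - p) ^+ 2 / 4.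
  by rewrite /q; field; rewrite gt_eqF.
rewrite -/E.
have half (x y : R) : D%:R * ((q - p) ^+ 2 / 2) <= y ->
    expR (- y) <= E * E.
  by move=> h; rewrite -expRD ler_expR; lra.
have DG := ler_wpM2l (ltW N0) G.
(* [M] is the prefactor: sqrt (D / n), or sqrt D when n = 0. *)
have [M [M0 hM MD Mq]] : exists M, [/\ 0 <= M,
    scaled_poisson p D n <= M * (E * E), M <= D%:R & p / 2 <= q -> M <= 2 / p].
  have [n0|n0] := posnP n.
    exists (Num.sqrt D%:R); split; rewrite ?sqrtr_ge0 ?sqrt_le //.
      rewrite /scaled_poisson n0 expr0 mul1r fact0 divr1 ler_wpM2l ?sqrtr_ge0 //.
      apply: half => //; apply: le_trans DG _.
      by rewrite /q n0 !mul0r; lra.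
    by rewrite /q n0 mul0r; lra.
  have qp : 0 < q by rewrite divr_gt0 // ltr0n.
  have sE : Num.sqrt q^-1 = expR (- ln q / 2).
    rewrite -[LHS]lnK ?posrE ?sqrtr_gt0 ?invr_gt0 //; congr expR.
    by rewrite ln_sqrtr ?invr_gt0 // lnV ?posrE.
  have sq : Num.sqrt q^-1 <= q^-1 by apply: sqrt_le; rewrite invf_ge1.
  exists (Num.sqrt q^-1); split; rewrite ?sqrtr_ge0 //.
  - have /andP[r0 _] := @stirling_gap_bounds R n n0.
    rewrite sE (@scaled_poissonE R p D n) // -!expRD ler_expR -/q.
    lra.
  - apply: le_trans sq _; rewrite /q invf_div ler_pdivrMr ?ltr0n //.
    by rewrite ler_peMr ?ler1n // ltW.
  - move=> h; apply: le_trans sq _.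
    by rewrite -[leRHS]invf_div lef_pV2 ?posrE //; lra.
have E0 : 0 < E by exact: expR_gt0.
have E1 : E <= 1 by rewrite -expR0 ler_expR oppr_le0 divr_ge0 // mulr_ge0 ?sqr_ge0 // ltW.
apply: le_trans hM _; rewrite mulrA; apply: ler_wpM2r; first exact: ltW.
have p20 : 0 < p ^+ 2 by rewrite exprn_gt0.
(* For [p / 2 <= q] the prefactor is bounded; otherwise one factor [E] is at most 16 / (D p^2) and
   absorbs [M <= D]. *)
have [h|h] := leP (p / 2) q.
  apply: (@le_trans _ _ (2 / p)).
    have := Mq h; nra.
  have -> : 2 / p = 2 * p / p ^+ 2 by field; rewrite gt_eqF.
  by rewrite ler_wpM2r ?invr_ge0 ?ltW //; lra.
apply: (@le_trans _ _ (D%:R * E)); first by rewrite ler_wpM2r // ltW.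
have : E <= (D%:R * p ^+ 2 / 16)^-1.
  have hy : 0 < D%:R * p ^+ 2 / 16 by rewrite divr_gt0 // mulr_gt0.
  apply: (@le_trans _ _ (expR (- (D%:R * p ^+ 2 / 16)))).
    rewrite ler_expR lerN2.
    have : p ^+ 2 / 4 <= (q - p) ^+ 2 by nra.
    by move=> /(ler_wpM2l (ltW N0)); lra.
  rewrite expRN lef_pV2 ?posrE ?expR_gt0 //.
  by apply: le_trans (expR_ge1Dx _); lra.
move=> /(ler_wpM2l (ltW N0)) h'; apply: le_trans h' _.
rewrite le_eqVlt; apply/orP; left; apply/eqP; field.
by rewrite !gt_eqF.
Qed.

Lemma cvg_expR (R : realType) (T : Type) (F : set_system T) {FF : Filter F}
    (f : T -> R) (l : R) : f @ F --> l -> expR (f t) @[t --> F] --> expR l.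
Proof. by move=> fl; apply: (cvg_comp _ _ fl); exact: continuous_expR. Qed.

Lemma cvg_ln (R : realType) (T : Type) (F : set_system T) {FF : Filter F}
    (f : T -> R) (l : R) : 0 < l -> f @ F --> l -> ln (f t) @[t --> F] --> ln l.
Proof. by move=> l0 fl; apply: (cvg_comp _ _ fl); exact: continuous_ln. Qed.

Lemma cvg_exprn (R : realType) (T : Type) (F : set_system T) {FF : Filter F}
    (f : T -> R) (l : R) (k : nat) :
  f @ F --> l -> (f t ^+ k) @[t --> F] --> l ^+ k.
Proof.
move=> fl; elim: k => [|k IH].
  by rewrite expr0; under eq_fun do rewrite expr0; exact: cvg_cst.
by rewrite exprS; under eq_fun do rewrite exprS; exact: cvgM.
Qed.

Lemma cvg_inv_sqrt_nat (R : realType) (D : nat -> nat) :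
    D @ \oo --> \oo -> (Num.sqrt (D m)%:R)^-1 @[m --> \oo] --> (0 : R).
Proof.
move=> /cvgrnyP - /(_ R) Doo.
have D0 : \forall m \near \oo, 0 < (D m)%:R :> R.
  by move/cvgryPgt : Doo; apply.
rewrite -[X in _ --> X]sqrtr0.
under eq_fun do rewrite -sqrtrV ?ler0n //.
have V0 : (D m)%:R^-1 @[m --> \oo] --> (0 : R) by apply/gtr0_cvgV0.
by apply: (cvg_comp _ _ V0); exact: sqrt_continuous.
Qed.

(** Local limit theorem at the rescaled deviation [h]. With s = 1 / sqrt D and y the rescaled
    deviation at index m, n = D (p + y s), so the relative entropy is expanded at x = y s / p. *)
Lemma cvg_scaled_poisson (R : realType) (kappa p h : R) (D n : nat -> nat) :
    stirling_gap R @ \oo --> kappa -> 0 < p -> D @ \oo --> \oo ->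
    ((n m)%:R - p * (D m)%:R) / Num.sqrt (D m)%:R @[m --> \oo] --> h ->
  scaled_poisson p (D m) (n m) @[m --> \oo] -->
    expR (- kappa - ln p / 2 - h ^+ 2 / (2 * p)).
Proof.
move=> gap_kappa p0 Doo; set y := (fun m => _ / _) => y_h.
have s0 := @cvg_inv_sqrt_nat R D Doo.
set s := (fun m => (Num.sqrt (D m)%:R)^-1) in s0.
have D0 : \forall m \near \oo, 0 < (D m)%:R :> R.
  by move/(@cvgrnyP R)/cvgryPgt : Doo; apply.
have sD m : 0 < (D m)%:R :> R -> s m ^+ 2 = (D m)%:R^-1.
  by move=> ?; rewrite /s exprVn sqr_sqrtr // ler0n.
have sP m : 0 < (D m)%:R :> R -> 0 < s m by move=> ?; rewrite /s invr_gt0 sqrtr_gt0.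
have nE m : 0 < (D m)%:R :> R -> (n m)%:R = (D m)%:R * (p + y m * s m).
  move=> d0; have h0 := sP m d0.
  have e : y m * s m = ((n m)%:R - p * (D m)%:R) / (D m)%:R.
    by rewrite -(sD _ d0) /y -/(s m) expr2 mulrA.
  by rewrite e; field; rewrite gt_eqF.
clearbody y s.
have ys0 : y m * s m @[m --> \oo] --> (0 : R).
  by rewrite -(mulr0 h); apply: cvgM.
have q_p : p + y m * s m @[m --> \oo] --> p.
  by rewrite -[X in _ --> X]addr0; apply: cvgD => //; exact: cvg_cst.
have q0 : \forall m \near \oo, 0 < p + y m * s m by exact: cvgr_gt q_p _ p0.
have n_oo : n @ \oo --> \oo.
  apply/(@cvgrnyP R)/cvgryPge => A.
  have q2 : \forall m \near \oo, p / 2 < p + y m * s m.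
    by apply: cvgr_gt q_p _ _; lra.
  have DA : \forall m \near \oo, A / (p / 2) <= (D m)%:R.
    by move/(@cvgrnyP R)/cvgryPge : Doo; apply.
  near=> m.
  rewrite nE; last by near: m.
  apply: (@le_trans _ _ ((D m)%:R * (p / 2))).
    by rewrite -ler_pdivrMr; [near: m; exact: DA|lra].
  by apply: ler_wpM2l => //; apply: ltW; near: m; exact: q2.
have small : \forall m \near \oo, `|y m * s m / p| <= 2^-1.
  have : y m * s m / p @[m --> \oo] --> (0 : R) by rewrite -(mul0r p^-1); apply: cvgMl.
  by move=> /cvgr0Pnorm_le; apply; rewrite invr_gt0.
(* Since D s^2 = 1, the quadratic term is exactly y^2 / (2p) and the cubic error is of order |y|^3
   s. *)
have main : (D m)%:R * ((p + y m * s m) * (ln (p + y m * s m) - ln p)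
     - (p + y m * s m) + p) @[m --> \oo] --> h ^+ 2 / (2 * p).
  have : h ^+ 2 / (2 * p) = h ^+ 2 / (2 * p) + 0 by rewrite addr0.
  move=> ->.
  apply: (@cvg_trans _ ((fun m => y m ^+ 2 / (2 * p) + 
   ((D m)%:R * ((p + y m * s m) * (ln (p + y m * s m) - ln p)
     - (p + y m * s m) + p) - y m ^+ 2 / (2 * p))) @ \oo)).
    by apply: near_eq_cvg; near=> m; rewrite addrC subrK.
  apply: cvgD.
    by apply: cvgMl; exact: cvg_exprn.
  apply/norm_cvg0P.
  have lim0 : 2 * (`|y m| ^+ 3 * s m) / p ^+ 2 @[m --> \oo] --> (0 : R).
    rewrite -[X in _ --> X](mul0r (p ^+ 2)^-1); apply: cvgMl.
    rewrite -[X in _ --> X](mulr0 2); apply: cvgMr.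
    rewrite -[X in _ --> X](mulr0 (`|h| ^+ 3)); apply: cvgM => //.
    by apply: cvg_exprn; exact: cvg_norm.
  apply: (squeeze_cvgr _ (cvg_cst 0) lim0).
  near=> m; rewrite normr_ge0 /=.
  have d0 : 0 < (D m)%:R :> R by near: m.
  have sm := sP m d0; have sDm := sD m d0.
  have hx : `|y m * s m / p| <= 2^-1 by near: m; exact: small.
  pose x := y m * s m / p; rewrite -/x in hx.
  have xe : p + y m * s m = p * (1 + x) by rewrite /x; field; rewrite gt_eqF.
  have /andP[x1 x2] : - 2^-1 <= x <= 2^-1 by rewrite -ler_norml.
  have x0 : 0 < 1 + x by lra.
  have := rel_entropy_taylor hx.
  rewrite xe lnM ?posrE //.
  have dd : (D m)%:R = (s m ^+ 2)^-1 by rewrite sDm invrK.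
  have -> : (D m)%:R * (p * (1 + x) * (ln p + ln (1 + x) - ln p) - p * (1 + x) + p)
     - y m ^+ 2 / (2 * p) =
     (D m)%:R * p * ((1 + x) * ln (1 + x) - x - x ^+ 2 / 2).
    by rewrite dd /x; field; rewrite !gt_eqF.
  have dp0 : 0 <= (D m)%:R * p by rewrite mulr_ge0 ?ler0n // ltW.
  move=> /(ler_wpM2l dp0) h'; rewrite normrM (ger0_norm dp0); apply: le_trans h' _.
  rewrite /x !normrM normfV (gtr0_norm sm) (gtr0_norm p0) dd.
  rewrite le_eqVlt; apply/orP; left; apply/eqP; field.
  by rewrite !gt_eqF.
apply: (@cvg_trans _ ((fun m => expR (- stirling_gap R (n m)
  - ln (p + y m * s m) / 2 - (D m)%:R * ((p + y m * s m) * (ln (p + y m * s m) - ln p)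
     - (p + y m * s m) + p))) @ \oo)).
  apply: near_eq_cvg; near=> m.
  have d0 : 0 < (D m)%:R :> R by near: m.
  have n0 : (0 < n m)%N.
    rewrite -(ltr0n R) nE // mulr_gt0 //; near: m; exact: q0.
  rewrite (@scaled_poissonE R p (D m) (n m)) // -?(ltr0n R) //.
  have -> // : (n m)%:R / (D m)%:R = p + y m * s m.
  by rewrite nE // mulrC mulKf // gt_eqF.
apply: cvg_expR; apply: cvgB => //.
apply: cvgB.
  by apply: cvgN; exact: (cvg_comp _ _ n_oo).
by apply: cvgMl; exact: cvg_ln.
Unshelve. all: by end_near.
Qed.

(** * Gaussian integrals, and sums as integrals of step functions *)

Lemma integral_gauss (R : realType) (c : R) : 0 < c ->
  (@lebesgue_measure R).-integrable setT (EFin \o (fun z => expR (- (c * z ^+ 2)))) /\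
  (\int[@lebesgue_measure R]_z (expR (- (c * z ^+ 2)))%:E = (Num.sqrt (pi / c))%:E)%E.
Proof.
move=> c0.
have pic : 0 < Num.sqrt (pi / c) :> R by rewrite sqrtr_gt0 divr_gt0 ?pi_gt0.
pose sigma : R := Num.sqrt (2 * c)^-1.
have c2 : 0 < (2 * c)^-1 by rewrite invr_gt0 mulr_gt0.
have sigma2 : sigma ^+ 2 = (2 * c)^-1 by rewrite sqr_sqrtr // ltW.
have sigma0 : sigma != 0 by rewrite gt_eqF // sqrtr_gt0.
have E z : (expR (- (c * z ^+ 2)))%:E =
    ((Num.sqrt (pi / c))%:E * (normal_pdf 0 sigma z)%:E)%E.
  rewrite -EFinM; congr EFin.
  rewrite /normal_pdf (negPf sigma0) /normal_peak /normal_fun sigma2 subr0.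
  have -> : (2 * c)^-1 * pi *+ 2 = pi / c.
    by rewrite -mulr_natr; field; rewrite gt_eqF.
  rewrite mulVKf ?gt_eqF //; congr expR.
  by rewrite -mulr_natr; field; rewrite gt_eqF.
have i := @integrable_normal_pdf R 0 sigma.
split.
  have -> : EFin \o (fun z => expR (- (c * z ^+ 2))) =
    (fun z => (Num.sqrt (pi / c))%:E * (normal_pdf 0 sigma z)%:E)%E.
    by apply/funext => z; exact: E.
  exact: integrableZl.
under eq_integral do rewrite E.
rewrite integralZl //.
by rewrite integral_normal_pdf mule1.
Qed.

(** The points [z] with floor value [j] form a half-open interval of length 1 / s. In this form
    dominated convergence applies to the sum. *)
Lemma integral_step (R : realType) (g : int -> R) (J : set int) (s c : R) :
    finite_set J -> (forall j, 0 <= g j) -> (forall j, ~ J j -> g j = 0) ->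
    0 < s ->
  measurable_fun setT (fun z : R => g (Num.floor (z * s + c))) /\
  (\int[@lebesgue_measure R]_z (g (Num.floor (z * s + c)))%:E =
    (s^-1 * \sum_(j \in J) g j)%:E)%E.
Proof.
move=> finJ g0 gJ s0.
pose I (j : int) : set R := [set` `[(j%:~R - c) / s, ((j + 1)%:~R - c) / s[].
have IE j z : I j z = (Num.floor (z * s + c) = j) :> Prop.
  apply/propext; rewrite /I /= in_itv /= ler_pdivrMr // ltr_pdivlMr //.
  rewrite lerBlDr ltrBrDr; split => [zj|<-]; first by apply: floor_def.
  exact: floor_itv.
have E z : (g (Num.floor (z * s + c)))%:E =
    (\sum_(j \in J) ((g j)%:E * (\1_(I j) z)%:E))%E.
  set j0 := Num.floor _.
  have I0 : I j0 z by rewrite IE.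
  have In j : j != j0 -> ~ I j z by rewrite IE => /eqP + e; apply.
  have [Jj|nJj] := pselect (J j0).
    rewrite -(@fsbig_widen _ _ _ _ [set j0]).
    - by rewrite fsbig_set1 indicE mem_set // mule1.
    - by move=> _ ->.
    - by move=> j /= [_ /eqP jj0]; rewrite indicE memNset ?mule0 //; exact: In.
  rewrite fsbig1 ?gJ // => j Jj.
  rewrite indicE memNset ?mule0 //; apply: In.
  by apply: contra_notN nJj => /eqP <-.
have mI j : measurable (I j) by exact: measurable_itv.
have mE j : measurable_fun setT (EFin \o (\1_(I j) : R -> R)).
  by apply/measurable_EFinP; exact: measurable_indic.
have mT j := measurable_funeM (g j)%:E (mE j).
have h0 j (z : R) : setT z -> (0 <= (g j)%:E * (\1_(I j) z)%:E)%E.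
  by move=> _; rewrite mule_ge0 ?lee_fin.
split.
  apply/measurable_EFinP; rewrite /comp; under eq_fun do rewrite E.
  exact: emeasurable_fsum.
have muI j : @lebesgue_measure R (I j) = (s^-1)%:E.
  rewrite /I lebesgue_measure_itv /= lte_fin ifT; last first.
    by rewrite ltr_pM2r ?invr_gt0 // ltrD2r ltr_int ltrDl.
  rewrite -EFinB; congr EFin.
  by rewrite intrD; field; rewrite gt_eqF.
under eq_integral do rewrite E.
rewrite ge0_integral_fsum //.
transitivity (\sum_(j \in J) (g j * s^-1)%:E)%E.
  apply: eq_fsbigr => j _.
  rewrite ge0_integralZl_EFin //; last exact: mE.
  rewrite integral_indic //; last exact: mI.
  rewrite (_ : _ `&` _ = I j); last exact: setIT.
  by rewrite EFinM; congr (_ * _)%E; exact: muI.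
rewrite fsumEFin //; congr EFin.
by rewrite mulr_fsumr //; apply: eq_fsbigr => j _; exact: mulrC.
Qed.

(** * Products of Poisson weights along a line *)

(* The arguments of the factorials at the [j]-th lattice point of the line that
   starts at [n0] and has direction [w]. *)
Definition line_count (N : nat) (n0 w : 'I_N -> int) (j : int) (i : 'I_N) : int :=
  n0 i + j * w i.

Definition line_points (N : nat) (n0 w : 'I_N -> int) : set int :=
  [set j | forall i, 0 <= line_count n0 w j i].

Lemma line_count_le (N : nat) (n0 w : 'I_N -> int) (j : int) (i : 'I_N) :
    \sum_i w i = 0 -> line_points n0 w j ->
  line_count n0 w j i <= \sum_i n0 i.
Proof.
move=> w0 Jj.
have -> : \sum_i n0 i = \sum_i line_count n0 w j i.
  by rewrite big_split /= -mulr_sumr w0 mulr0 addr0.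
by rewrite (bigD1 i) //= lerDl; apply: sumr_ge0 => k _; exact: Jj.
Qed.

(** A coordinate with [w i != 0] is injective in [j] and lies between 0 and the constant sum of the
    entries. *)
Lemma finite_line_points (N : nat) (n0 w : 'I_N -> int) :
    \sum_i w i = 0 -> (exists i, w i != 0) -> finite_set (line_points n0 w).
Proof.
move=> w0 [i wi].
pose B := [set x : int | 0 <= x <= \sum_i n0 i].
have finB : finite_set B.
  refine (sub_finite_set _ (finite_image Posz (finite_II (absz (\sum_i n0 i)).+1))).
  move=> x /= /andP[x0 xs]; exists `|x|%N; last by rewrite gez0_abs.
  by rewrite /= ltnS -lez_nat !gez0_abs // (le_trans x0).
have : finite_set ((fun j => line_count n0 w j i) @^-1` B).
  apply: finite_preimage => // j k _ _ /addrI; exact: mulIf.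
apply: sub_finite_set => j Jj /=.
by rewrite /B /= Jj line_count_le.
Qed.

(** The value 0 at points with a negative entry matters: [absz] would give a meaningless weight
    there, and the step function must have finite support. *)
Definition line_weight (R : realType) (N : nat) (p : 'I_N -> R) (D : nat)
    (n0 w : 'I_N -> int) (j : int) : R :=
  if [forall i, 0 <= line_count n0 w j i] then
    \prod_i scaled_poisson (p i) D (absz (line_count n0 w j i))
  else 0.

Lemma line_weight_ge0 (R : realType) (N : nat) (p : 'I_N -> R) (D : nat)
    (n0 w : 'I_N -> int) (j : int) :
  (forall i, 0 < p i) -> (0 < D)%N -> 0 <= line_weight p D n0 w j.
Proof.
move=> p0 D0; rewrite /line_weight; case: ifP => // _.
by apply: prodr_ge0 => i _; apply/ltW/scaled_poisson_gt0.
Qed.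

Lemma line_weight_out (R : realType) (N : nat) (p : 'I_N -> R) (D : nat)
    (n0 w : 'I_N -> int) (j : int) :
  ~ line_points n0 w j -> line_weight p D n0 w j = 0.
Proof. by rewrite /line_weight; case: ifP => // /forallP. Qed.

(** The entries deviate from their means by [(j - c) * w i], so the exponents of [scaled_poisson_le]
    add up to a multiple of (j - c)^2 / D. *)
Lemma line_weight_le (R : realType) (N : nat) (p : 'I_N -> R) (D : nat)
    (n0 w : 'I_N -> int) (c : R) (j : int) :
    (forall i, 0 < p i) -> \sum_i p i = 1 -> \sum_i w i = 0 -> (0 < D)%N ->
    (forall i, (n0 i)%:~R = p i * D%:R - c * (w i)%:~R) ->
  line_weight p D n0 w j <= \prod_i (16 / p i ^+ 2) *
    expR (- ((\sum_i (w i)%:~R ^+ 2) / 4 * ((j%:~R - c) ^+ 2 / D%:R))).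
Proof.
move=> p0 p1 w0 D0 n0E; rewrite /line_weight; case: ifP => [/forallP Jj|_]; last first.
  rewrite mulr_ge0 ?expR_ge0 //; apply: prodr_ge0 => i _.
  by rewrite divr_ge0 ?sqr_ge0.
have pi1 i : p i <= 1.
  by rewrite -p1 (bigD1 i) //= lerDl; apply: sumr_ge0 => k _; exact: ltW.
have sumn0 : \sum_i n0 i = D.
  have : (\sum_i n0 i)%:~R = D%:R :> R.
    rewrite raddf_sum /=; under eq_bigr do rewrite n0E.
    by rewrite sumrB -mulr_suml -mulr_sumr p1
      -[\sum_i _ in X in _ - X](raddf_sum (intr : int -> R)) w0 mulr0 mul1r subr0.
  by rewrite -[RHS]/((Posz D)%:~R) => /intr_inj.
have cntE i : (absz (line_count n0 w j i))%:R = p i * D%:R + (j%:~R - c) * (w i)%:~R :> R.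
  rewrite -[LHS]/((Posz _)%:~R) gez0_abs // /line_count intrD intrM n0E.
  by ring.
rewrite mulr_suml mulr_suml -sumrN expR_sum -big_split /=.
apply: ler_prod => i _; rewrite ltW ?scaled_poisson_gt0 //=.
have := @scaled_poisson_le R (p i) D (absz (line_count n0 w j i)).
rewrite p0 pi1 D0 cntE => /(_ isT isT) h.
apply: le_trans (h _) _.
  by rewrite -lez_nat gez0_abs // -sumn0 line_count_le.
rewrite le_eqVlt; apply/orP; left; apply/eqP; congr (_ * expR (- _)).
by field; rewrite gt_eqF // ltr0n.
Qed.

Lemma line_weight_floor_le (R : realType) (N : nat) (p : 'I_N -> R) (D : nat)
    (n0 w : 'I_N -> int) (c z : R) :
    (forall i, 0 < p i) -> \sum_i p i = 1 -> \sum_i w i = 0 -> (0 < D)%N ->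
    (forall i, (n0 i)%:~R = p i * D%:R - c * (w i)%:~R) ->
  line_weight p D n0 w (Num.floor (z * Num.sqrt D%:R + c)) <=
  \prod_i (16 / p i ^+ 2) * expR ((\sum_i (w i)%:~R ^+ 2) / 4) *
    expR (- ((\sum_i (w i)%:~R ^+ 2) / 8 * z ^+ 2)).
Proof.
move=> p0 p1 w0 D0 n0E; pose W : R := \sum_i (w i)%:~R ^+ 2; rewrite -/W.
apply: le_trans (line_weight_le _ p0 p1 w0 D0 n0E) _.
rewrite -[leRHS]mulrA; apply: ler_wpM2l.
  by apply: prodr_ge0 => i _; rewrite divr_ge0 ?sqr_ge0.
rewrite -/W -expRD ler_expR.
have W0 : 0 <= W by apply: sumr_ge0 => i _; exact: sqr_ge0.
have D1 : 1 <= D%:R :> R by rewrite ler1n.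
set s := Num.sqrt D%:R.
have s2 : s ^+ 2 = D%:R by rewrite sqr_sqrtr ?ler0n.
have := floor_itv (z * s + c); set j := Num.floor _; rewrite intrD.
move=> /andP[j1 j2].
(* With [t] in [0, 1) the rounding error and s^2 = D >= 1, this is (z s - t)^2 >= (z s)^2 / 2 - t^2;
   it halves the exponent and costs the factor exp (W / 4). *)
have key : z ^+ 2 / 2 - 1 <= (j%:~R - c) ^+ 2 / D%:R.
  rewrite ler_pdivlMr ?(lt_le_trans ltr01) //.
  pose t := z * s + c - j%:~R.
  have -> : j%:~R - c = z * s - t by rewrite /t; ring.
  have t0 : 0 <= t by rewrite /t; lra.
  have t1 : t < 1 by rewrite /t; lra.
  have : t ^+ 2 <= 1 by nra.
  have : 0 <= (z * s - 2 * t) ^+ 2 by exact: sqr_ge0.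
  rewrite -s2 in D1 *; nra.
have := ler_wpM2l W0 key; lra.
Qed.

Lemma cvg_prodr (R : realType) (T : Type) (F : set_system T) {FF : Filter F}
    (I : Type) (r : seq I) (f : I -> T -> R) (l : I -> R) :
    (forall i, f i @ F --> l i) ->
  \prod_(i <- r) f i t @[t --> F] --> \prod_(i <- r) l i.
Proof.
move=> fl; elim: r => [|i r IH].
  by rewrite big_nil; under eq_fun do rewrite big_nil; exact: cvg_cst.
by rewrite big_cons; under eq_fun do rewrite big_cons; exact: cvgM.
Qed.

(** For fixed [z] the rounded index satisfies (j - c) / sqrt D -> z, so [cvg_scaled_poisson] applies
    to factor [i] with the deviation [z * w i]. *)
Lemma cvg_line_weight (R : realType) (N : nat) (kappa : R) (p : 'I_N -> R)
    (w : 'I_N -> int) (D : nat -> nat) (n0 : nat -> 'I_N -> int)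
    (c : nat -> R) (z : R) :
    stirling_gap R @ \oo --> kappa -> (forall i, 0 < p i) ->
    D @ \oo --> \oo ->
    (forall m i, (n0 m i)%:~R = p i * (D m)%:R - c m * (w i)%:~R) ->
  line_weight p (D m) (n0 m) w (Num.floor (z * Num.sqrt (D m)%:R + c m))
    @[m --> \oo] -->
  expR (- N%:R * kappa - (\sum_i ln (p i)) / 2)
    * expR (- ((\sum_i (w i)%:~R ^+ 2 / p i) / 2 * z ^+ 2)).
Proof.
move=> gap p0 Doo n0E.
pose j m := Num.floor (z * Num.sqrt (D m)%:R + c m).
pose s m : R := (Num.sqrt (D m)%:R)^-1.
have s0 : s @ \oo --> (0 : R) by exact: cvg_inv_sqrt_nat.
have D0 : \forall m \near \oo, 0 < (D m)%:R :> R.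
  by move/(@cvgrnyP R)/cvgryPgt : Doo; apply.
have sP m : 0 < (D m)%:R :> R -> 0 < s m by move=> ?; rewrite /s invr_gt0 sqrtr_gt0.
have sD m : 0 < (D m)%:R :> R -> (D m)%:R = (s m ^+ 2)^-1.
  by move=> ?; rewrite /s exprVn sqr_sqrtr ?ler0n // invrK.
pose y m : R := (j m)%:~R - c m.
have ys : y m * s m @[m --> \oo] --> z.
  have zs0 : z - s m @[m --> \oo] --> z.
    by rewrite -[X in _ --> X]subr0; apply: cvgB => //; exact: cvg_cst.
  apply: (squeeze_cvgr _ zs0 (cvg_cst z)).
  near=> m; have d0 : 0 < (D m)%:R :> R by near: m.
  have sm := sP m d0.
  have -> : z = (z * Num.sqrt (D m)%:R) * s m by rewrite mulfK // gt_eqF // sqrtr_gt0.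
  have := floor_itv (z * Num.sqrt (D m)%:R + c m).
  rewrite -/(j m) intrD => /andP[j1 j2].
  rewrite /y -[X in _ - X]mul1r -mulrBl !ler_pM2r //; apply/andP; split; lra.
have cntE m i : (line_count (n0 m) w (j m) i)%:~R =
    p i * (D m)%:R + y m * (w i)%:~R :> R.
  by rewrite /line_count intrD intrM n0E /y; ring.
(* Each entry is D times a quantity tending to [p i], so the zero branch of [line_weight] is
   eventually not taken. *)
have cnt0 i : \forall m \near \oo, 0 <= line_count (n0 m) w (j m) i.
  have h : p i + y m * s m * (w i)%:~R * s m @[m --> \oo] --> p i.
    rewrite -[X in _ --> X]addr0; apply: cvgD; first exact: cvg_cst.
    rewrite -[X in _ --> X](mulr0 (z * (w i)%:~R)); apply: cvgM => //.
    by apply: cvgMl.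
  have h0 : \forall m \near \oo, 0 < p i + y m * s m * (w i)%:~R * s m.
    by exact: cvgr_gt h _ (p0 i).
  near=> m; have d0 : 0 < (D m)%:R :> R by near: m.
  have sm := sP m d0.
  rewrite -(ler0z R) cntE.
  have -> : p i * (D m)%:R + y m * (w i)%:~R =
     (D m)%:R * (p i + y m * s m * (w i)%:~R * s m).
    by rewrite (sD m d0); field; rewrite gt_eqF.
  by rewrite mulr_ge0 // ltW //; near: m; exact: h0.
have -> : expR (- N%:R * kappa - (\sum_i ln (p i)) / 2)
    * expR (- ((\sum_i (w i)%:~R ^+ 2 / p i) / 2 * z ^+ 2)) =
  \prod_i expR (- kappa - ln (p i) / 2 - (z * (w i)%:~R) ^+ 2 / (2 * p i)).
  rewrite -expRD -expR_sum; congr expR.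
  have e1 : \sum_i ln (p i) / 2 = (\sum_i ln (p i)) / 2 by rewrite mulr_suml.
  have e2 : \sum_i (z * (w i)%:~R) ^+ 2 / (2 * p i) =
      (\sum_i (w i)%:~R ^+ 2 / p i) / 2 * z ^+ 2.
    by rewrite !mulr_suml; apply: eq_bigr => i _; field; rewrite gt_eqF.
  have e3 : \sum_(i < N) - kappa = - N%:R * kappa.
    by rewrite sumr_const card_ord mulNrn -[kappa *+ N]mulr_natl mulNr.
  by rewrite !sumrB e1 e2 e3.
apply: (@cvg_trans _ ((fun m => \prod_i scaled_poisson (p i) (D m)
    (absz (line_count (n0 m) w (j m) i))) @ \oo)).
  apply: near_eq_cvg.
  have : \forall m \near \oo, forall i, 0 <= line_count (n0 m) w (j m) i.
    exact: filter_forall.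
  apply: filterS => m /forallP hm.
  by rewrite /line_weight -/(j m) hm.
apply: cvg_prodr => i.
apply: cvg_scaled_poisson => //.
apply: (@cvg_trans _ ((fun m => y m * s m * (w i)%:~R) @ \oo)); last exact: cvgMl.
apply: near_eq_cvg; near=> m.
have c0 : 0 <= line_count (n0 m) w (j m) i by near: m; exact: cnt0.
rewrite -[X in _ = (X - _) / _]/((Posz _)%:~R) gez0_abs // cntE.
by rewrite addrAC subrr add0r mulrAC.
Unshelve. all: by end_near.
Qed.

(** The factor 1 / sqrt D is the step width in [integral_step]; the pointwise limit is
    [cvg_line_weight] and the majorant [line_weight_floor_le]. *)
Lemma cvg_sum_line_weight (R : realType) (N : nat) (kappa : R) (p : 'I_N -> R)
    (w : 'I_N -> int) (D : nat -> nat) (n0 : nat -> 'I_N -> int)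
    (c : nat -> R) :
    stirling_gap R @ \oo --> kappa -> (forall i, 0 < p i) -> \sum_i p i = 1 ->
    \sum_i w i = 0 -> (exists i, w i != 0) ->
    D @ \oo --> \oo -> (forall m, (0 < D m)%N) ->
    (forall m i, (n0 m i)%:~R = p i * (D m)%:R - c m * (w i)%:~R) ->
  (Num.sqrt (D m)%:R)^-1 *
    \sum_(j \in line_points (n0 m) w) line_weight p (D m) (n0 m) w j
    @[m --> \oo] -->
  expR (- N%:R * kappa - (\sum_i ln (p i)) / 2)
    * Num.sqrt (2 * pi / (\sum_i (w i)%:~R ^+ 2 / p i)).
Proof.
move=> gap p0 p1 w0 wn0 Doo D0 n0E.
set K := expR (- N%:R * kappa - _); set S := \sum_i (w i)%:~R ^+ 2 / p i.
have wsq i : w i != 0 -> 0 < (w i)%:~R ^+ 2 :> R.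
  by move=> wi; rewrite exprn_even_gt0 // intr_eq0.
have S0 : 0 < S.
  have [i wi] := wn0; rewrite /S (bigD1 i) //= ltr_pwDl ?divr_gt0 ?wsq //.
  by apply: sumr_ge0 => k _; rewrite divr_ge0 ?sqr_ge0 // ltW.
pose W : R := \sum_i (w i)%:~R ^+ 2.
have W0 : 0 < W.
  have [i wi] := wn0; rewrite /W (bigD1 i) //= ltr_pwDl ?wsq //.
  by apply: sumr_ge0 => k _; rewrite sqr_ge0.
have step m := @integral_step R (line_weight p (D m) (n0 m) w)
  (line_points (n0 m) w) (Num.sqrt (D m)%:R) (c m)
  (finite_line_points (n0 m) w0 wn0)
  (fun j => line_weight_ge0 (n0 m) w j p0 (D0 m))
  (fun j => @line_weight_out R N p (D m) (n0 m) w j)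
  ltac:(by rewrite sqrtr_gt0 ltr0n).
have [iS eS] := @integral_gauss R (S / 2) ltac:(by rewrite divr_gt0).
have [iW _] := @integral_gauss R (W / 8) ltac:(by rewrite divr_gt0).
pose M : R := \prod_i (16 / p i ^+ 2) * expR (W / 4).
have f_cvg (z : R) : (line_weight p (D m) (n0 m) w
      (Num.floor (z * Num.sqrt (D m)%:R + c m)))%:E @[m --> \oo] -->
    (K%:E * (expR (- (S / 2 * z ^+ 2)))%:E)%E.
  apply: cvg_EFin; first by near=> m.
  exact: cvg_line_weight.
have f_le m (z : R) : (`|(line_weight p (D m) (n0 m) w
      (Num.floor (z * Num.sqrt (D m)%:R + c m)))%:E| <=
    M%:E * (expR (- (W / 8 * z ^+ 2)))%:E)%E.
  rewrite abse_EFin ger0_norm ?line_weight_ge0 // -EFinM lee_fin.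
  exact: line_weight_floor_le.
have mf m : measurable_fun setT (fun z : R => (line_weight p (D m) (n0 m) w
      (Num.floor (z * Num.sqrt (D m)%:R + c m)))%:E).
  by apply/measurable_EFinP; exact: (step m).1.
have fin (z : R) : (M%:E * (expR (- (W / 8 * z ^+ 2)))%:E)%E \is a fin_num by [].
have := @dominated_cvg _ _ R (@lebesgue_measure R) setT measurableT _ _ _
  mf (fun z _ => f_cvg z) (fun z _ => fin z) (integrableZl measurableT M iW)
  (fun m z _ => f_le m z).
rewrite (integralZl measurableT iS) eS -EFinM.
under eq_fun do rewrite (step _).2.
move=> /fine_cvgP[_]; rewrite /comp /=.
suff -> : 2 * pi / S = pi / (S / 2) by [].
by field; rewrite gt_eqF.
Unshelve. all: by end_near.
Qed.

(** * Sums of multinomial coefficients along a line *)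

Lemma factE_stirling (R : realType) (n : nat) :
  n`!%:R = expR (stirling_gap R n + (n%:R + 2^-1) * ln n%:R - n%:R) :> R.
Proof.
rewrite -[LHS]lnK ?posrE ?ltr0n ?fact_gt0 //; congr expR.
by rewrite /stirling_gap; ring.
Qed.

Lemma scaled_poisson_exp (R : realType) (p : R) (D n : nat) :
    0 < p -> (0 < D)%N ->
  scaled_poisson p D n =
  expR (ln D%:R / 2 + n%:R * (ln p + ln D%:R) - p * D%:R) / n`!%:R.
Proof.
move=> p0 D0; have N0 : 0 < D%:R :> R by rewrite ltr0n.
rewrite /scaled_poisson !expRD mulrA mulrA; congr (_ * _ / _).
rewrite -ln_sqrtr // lnK ?posrE ?sqrtr_gt0 //; congr (_ * _).
by rewrite -lnM ?posrE // mulr_natl -lnXn ?mulr_gt0 // lnK // posrE exprn_gt0 ?mulr_gt0.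
Qed.

Definition line_multinomial (R : realType) (N : nat) (D : nat)
    (n0 w : 'I_N -> int) (j : int) : R :=
  D`!%:R / \prod_i (absz (line_count n0 w j i))`!%:R.

(** In the summed exponent the terms in [j - c] carry the sums of [w i] and of [w i * ln (p i)],
    which vanish; the rest depends on [D] only. The power of D is -(N - 1) / 2: N factors sqrt D
    against the one in the factorial of [D]. *)
Lemma multinomial_line_weight (R : realType) (N : nat) (p : 'I_N -> R) (D : nat)
    (n0 w : 'I_N -> int) (c : R) (j : int) :
    (forall i, 0 < p i) -> \sum_i p i = 1 -> \sum_i w i = 0 ->
    \sum_i (w i)%:~R * ln (p i) = 0 -> (0 < D)%N ->
    (forall i, (n0 i)%:~R = p i * D%:R - c * (w i)%:~R) ->
    line_points n0 w j ->
  line_multinomial R D n0 w j =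
  expR (stirling_gap R D - (\sum_i p i * ln (p i)) * D%:R
    - (N%:R - 1) / 2 * ln D%:R) * line_weight p D n0 w j.
Proof.
move=> p0 p1 w0 wp D0 n0E Jj.
have cntE i : (absz (line_count n0 w j i))%:R = p i * D%:R + (j%:~R - c) * (w i)%:~R :> R.
  rewrite -[LHS]/((Posz _)%:~R) gez0_abs // /line_count intrD intrM n0E.
  by ring.
have w0R : \sum_i (w i)%:~R = 0 :> R.
  by rewrite -[LHS](raddf_sum (intr : int -> R)) w0.
rewrite /line_multinomial /line_weight ifT; last exact/forallP.
under [in RHS]eq_bigr do rewrite scaled_poisson_exp // cntE.
rewrite prodf_div -expR_sum mulrA -expRD [in LHS]factE_stirling.
congr (expR _ / _).
have -> : \sum_i (ln D%:R / 2 + (p i * D%:R + (j%:~R - c) * (w i)%:~R) *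
      (ln (p i) + ln D%:R) - p i * D%:R) =
    N%:R * (ln D%:R / 2) + (D%:R * \sum_i p i * ln (p i)
    + (j%:~R - c) * \sum_i (w i)%:~R * ln (p i)
    + (D%:R * ln D%:R) * \sum_i p i
    + (j%:~R - c) * ln D%:R * \sum_i (w i)%:~R) - D%:R * \sum_i p i.
  have -> : N%:R * (ln D%:R / 2) = \sum_(i < N) ln D%:R / 2 :> R.
    by rewrite sumr_const card_ord mulr_natl.
  rewrite !mulr_sumr -!big_split /= -sumrB.
  by apply: eq_bigr => i _; ring.
by rewrite p1 wp w0R; field.
Qed.

(** The sum over the line contributes one sqrt D, which turns (N - 1) / 2 into (N - 2) / 2. The
    coefficient of [kappa] is 1 from the factorial of [D] and -N from those in the denominator. *)
Lemma cvg_ln_line_sum (R : realType) (N : nat) (kappa : R) (p : 'I_N -> R)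
    (w : 'I_N -> int) (D : nat -> nat) (n0 : nat -> 'I_N -> int)
    (c : nat -> R) :
    stirling_gap R @ \oo --> kappa -> (forall i, 0 < p i) -> \sum_i p i = 1 ->
    \sum_i w i = 0 -> (exists i, w i != 0) ->
    \sum_i (w i)%:~R * ln (p i) = 0 ->
    D @ \oo --> \oo -> (forall m, (0 < D m)%N) ->
    (forall m i, (n0 m i)%:~R = p i * (D m)%:R - c m * (w i)%:~R) ->
  ln (\sum_(j \in line_points (n0 m) w) line_multinomial R (D m) (n0 m) w j)
    - (- (\sum_i p i * ln (p i)) * (D m)%:R - (N%:R - 2) / 2 * ln (D m)%:R)
    @[m --> \oo] -->
  (1 - N%:R) * kappa - (\sum_i ln (p i)) / 2 + ln (2 * pi) / 2
    - ln (\sum_i (w i)%:~R ^+ 2 / p i) / 2.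
Proof.
move=> gap p0 p1 w0 wn0 wp Doo D0 n0E.
have lim := cvg_sum_line_weight gap p0 p1 w0 wn0 Doo D0 n0E.
set K := expR _ in lim; set S := \sum_i (w i)%:~R ^+ 2 / p i in lim *.
have S0 : 0 < S.
  have [i wi] := wn0; rewrite /S (bigD1 i) //= ltr_pwDl ?divr_gt0 //.
    by rewrite exprn_even_gt0 // intr_eq0.
  by apply: sumr_ge0 => k _; rewrite divr_ge0 ?sqr_ge0 // ltW.
have piS : 0 < 2 * pi / S by rewrite divr_gt0 // mulr_gt0 ?pi_gt0.
have K0 : 0 < K * Num.sqrt (2 * pi / S) by rewrite mulr_gt0 ?expR_gt0 ?sqrtr_gt0.
set L := (fun m => (Num.sqrt (D m)%:R)^-1 * _) in lim.
have -> : (1 - N%:R) * kappa - (\sum_i ln (p i)) / 2 + ln (2 * pi) / 2 - ln S / 2 =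
    kappa + ln (K * Num.sqrt (2 * pi / S)).
  rewrite [ln (K * _)]lnM ?posrE ?expR_gt0 ?sqrtr_gt0 // /K expRK ln_sqrtr //.
  rewrite [ln (_ / S)]ln_div ?posrE //.
    by field.
  by rewrite mulr_gt0 ?pi_gt0.
have gapD : stirling_gap R (D m) @[m --> \oo] --> kappa by exact: (cvg_comp _ _ Doo).
apply: cvg_trans (cvgD gapD (cvg_ln K0 lim)).
apply: near_eq_cvg.
have : \forall m \near \oo, 0 < L m by exact: cvgr_gt lim _ K0.
apply: filterS => m L0.
have d0 : 0 < (D m)%:R :> R by rewrite ltr0n.
have -> : \sum_(j \in line_points (n0 m) w) line_multinomial R (D m) (n0 m) w j =
   expR (stirling_gap R (D m) - (\sum_i p i * ln (p i)) * (D m)%:R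
    - (N%:R - 1) / 2 * ln (D m)%:R) * (Num.sqrt (D m)%:R * L m) :> R.
  rewrite /L mulVKf ?gt_eqF ?sqrtr_gt0 // mulr_fsumr.
  apply: eq_fsbigr => j /set_mem Jj.
  exact: multinomial_line_weight.
have s0 : 0 < Num.sqrt (D m)%:R :> R by rewrite sqrtr_gt0.
rewrite (lnM (expR_gt0 _) (mulr_gt0 s0 L0)) expRK (lnM s0 L0) ln_sqrtr // fctE.
by field.
Qed.

(* [cvg_ln_line_sum] applied to the binomial coefficients, whose sum is known,
   is an equation for the limit. *)
Lemma stirling (R : realType) : stirling_gap R @ \oo --> ln (2 * pi) / 2.
Proof.
have := @cvg_stirling_gap R => /cvg_ex[/= kappa gap].
suff -> : ln (2 * pi) / 2 = kappa by [].
pose p (i : 'I_2) : R := 2^-1.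
pose w (i : 'I_2) : int := if i == 0 then 1 else -1.
pose n0 (m : nat) (i : 'I_2) : int := if i == 0 then 0 else m.+1.
have sum2 (V : nmodType) (F : 'I_2 -> V) : \sum_i F i = F 0 + F 1.
  by rewrite !big_ord_recl big_ord0 addr0; congr (_ + F _); apply/val_inj.
have w0 : \sum_i w i = 0 by rewrite sum2.
have wn0 : exists i, w i != 0 by exists 0.
have soo : S @ \oo --> \oo.
  by apply/cvgnyPge => A; exists A => // n /=; exact: leqW.
have pos (i : 'I_2) : 0 < p i by rewrite invr_gt0.
have p1 : \sum_i p i = 1 by rewrite sum2 /p; field.
have wp : \sum_i (w i)%:~R * ln (p i) = 0.
  by rewrite sum2 /p /w /= mul1r mulN1r subrr.
have n0E m i : (n0 m i)%:~R = p i * m.+1%:R - m.+1%:R / 2 * (w i)%:~R :> R.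
  by rewrite /n0 /w /p; case: ifP => _ /=; field.
have := cvg_ln_line_sum gap pos p1 w0 wn0 wp soo (fun=> isT) n0E.
have bin_sum m :
    \sum_(j \in line_points (n0 m) w) line_multinomial R m.+1 (n0 m) w j = 2 ^+ m.+1.
  have -> : 2 ^+ m.+1 = \sum_(k < m.+2) ('C(m.+1, k))%:R :> R.
    rewrite -natrX -[2%N]/(1 + 1)%N expnDn natr_sum.
    by apply: eq_bigr => k _; rewrite !exp1n !muln1.
  rewrite (fsbig_ord _ _ (fun k => ('C(m.+1, k))%:R)) (reindex_fsbig Posz `I_m.+2).
    apply: eq_fsbigr => k /set_mem /=; rewrite ltnS => km.
    rewrite /line_multinomial big_ord_recl big_ord1 /line_count /n0 /w /=.
    have -> : absz (m.+1%:Z + k%:Z * -1) = (m.+1 - k)%N by lia.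
    by rewrite muln1 add0n -natrM -(bin_fact km) natrM mulfK.
  split => [k /= km i|j k _ _ [] //|j Jj].
    by rewrite /line_count /n0 /w; case: ifP => _; lia.
  have := Jj 0; have := Jj 1; rewrite /line_count /n0 /w /= => j1 j0.
  by exists (absz j); lia.
(* The sum is exactly 2^(m + 1), so the whole sequence is 0 and its limit vanishes. *)
under eq_fun => m.
  rewrite bin_sum lnXn // !sum2 /p lnV ?posrE //.
  have -> : ln 2 *+ m.+1 - (- (2^-1 * - ln 2 + 2^-1 * - ln 2) * m.+1%:R
      - (2%:R - 2) / 2 * ln m.+1%:R) = 0 :> R.
    by rewrite -[_ *+ m.+1]mulr_natr; field.
  over.
move=> /cvg_lim; rewrite lim_cst // => /(_ (@Rhausdorff R)).
rewrite !sum2 /p /w /= lnV ?posrE //.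
(* The equation is - kappa + ln 2 + ln (2 pi) / 2 - ln 4 / 2 = 0. *)
have -> : (1%:~R ^+ 2 / 2^-1 + (-1)%:~R ^+ 2 / 2^-1 : R) = 2 ^+ 2 by field.
rewrite lnXn //; lra.
Qed.

(** * Determinants and positivity of the weights *)

(** The determinant of the columns (a_i, b_i) and (a, b); its sign compares their slopes. *)
Definition weight_det (N : nat) (a b : 'I_N -> nat) (i : 'I_N) : int :=
  (a i)%:Z * (weight_sum b)%:Z - (b i)%:Z * (weight_sum a)%:Z.

Lemma sum_weight_det (N : nat) (a b : 'I_N -> nat) :
  \sum_i weight_det a b i = 0.
Proof.
rewrite sumrB -!mulr_suml /weight_sum -!(raddf_sum Posz) /=; ring.
Qed.

Lemma toric_weights_dim_gt0 (R : realType) (N : nat) (a b : 'I_N -> nat) :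
  toric_weights R a b -> (0 < N)%N.
Proof.
move=> [_ _ dimS _]; rewrite lt0n; apply/eqP => N0.
have := leq_trans dimS (dimvS (subvf _)).
rewrite dimvf dim_matrix.
by rewrite N0 mulr0.
Qed.

Lemma toric_weights_swap (R : realType) (N : nat) (a b : 'I_N -> nat) :
  toric_weights R a b ->
  (forall i, ~ (b i = 0%N /\ a i = 0%N)) /\
  (forall i, ~ exists c : R, (weight_sum b)%:R = c * (b i)%:R /\
                   (weight_sum a)%:R = c * (a i)%:R).
Proof.
move=> [nz ns _ _]; split => i; first by move=> [? ?]; exact: (nz i).
by move=> [c [? ?]]; apply: (ns i); exists c.
Qed.

(** If the sum were 0, all [a i] would vanish and (0, b) would be a multiple of a column. The
    hypotheses are symmetric in the two rows, so that [toric_weights_swap] yields the same for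
    [b]. *)
Lemma weight_sum_gt0 (R : realType) (N : nat) (a b : 'I_N -> nat) :
    (0 < N)%N -> (forall i, ~ (a i = 0%N /\ b i = 0%N)) ->
    (forall i, ~ exists c : R, (weight_sum a)%:R = c * (a i)%:R /\
                   (weight_sum b)%:R = c * (b i)%:R) ->
  (0 < weight_sum a)%N.
Proof.
move=> N0 nz ns; rewrite lt0n; apply/eqP => a0.
pose i := Ordinal N0.
have ai : a i = 0%N.
  by move/eqP : a0; rewrite sum_nat_eq0 => /forallP/(_ i)/eqP.
have bi : b i != 0%N by apply/eqP => bi; exact: (nz i).
apply: (ns i); exists ((weight_sum b)%:R / (b i)%:R).
by rewrite ai a0 mulr0 divfK // pnatr_eq0.
Qed.

Lemma weight_det_neq0 (R : realType) (N : nat) (a b : 'I_N -> nat) (i : 'I_N) :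
  toric_weights R a b -> weight_det a b i != 0.
Proof.
move=> hW; have N0 := toric_weights_dim_gt0 hW.
have [nz ns _ _] := hW; have a0 := weight_sum_gt0 N0 nz ns.
rewrite subr_eq0 -!PoszM eqz_nat; apply/eqP => e.
have [ai|ai] := eqVneq (a i) 0%N.
  apply: (nz i); split=> //; move/esym/eqP : e.
  by rewrite ai mul0n muln_eq0 (gtn_eqF a0) orbF => /eqP.
apply: (ns i); exists ((weight_sum a)%:R / (a i)%:R).
rewrite divfK ?pnatr_eq0 //; split=> //.
by rewrite mulrAC -natrM mulnC -e natrM mulrAC divff ?pnatr_eq0 // mul1r.
Qed.

Lemma sum_weight_form (R : realType) (N : nat) (a b : 'I_N -> nat) (x y : R) :
  \sum_i weight_form a b x y i = (weight_sum a)%:R * x + (weight_sum b)%:R * y.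
Proof. by rewrite big_split /= -!mulr_suml /weight_sum !natr_sum. Qed.

Lemma root_pE (R : realType) (N : nat) (a b : 'I_N -> nat) (x y : R) (i : 'I_N) :
  root_p a b x y i = weight_form a b x y i / \sum_i weight_form a b x y i.
Proof.
by rewrite sum_weight_form /root_p /weight_form [x * _]mulrC [y * _]mulrC
  [x * _]mulrC [y * _]mulrC.
Qed.

Lemma root_poly_ln (R : realType) (N : nat) (a b : 'I_N -> nat) (x y : R) :
    (forall i, 0 < weight_form a b x y i) -> root_poly a b x y = 0 ->
  \sum_i (weight_det a b i)%:~R * ln (weight_form a b x y i) = 0.
Proof.
move=> u0 /eqP; rewrite subr_eq0 => /eqP e.
have prodE (k : 'I_N -> nat) : \prod_i weight_form a b x y i ^+ k i =
    expR (\sum_i (k i)%:R * ln (weight_form a b x y i)).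
  by rewrite expR_sum; apply: eq_bigr => i _; rewrite mulr_natl -lnXn // lnK // posrE exprn_gt0.
move: e; rewrite !prodE => /expR_inj e.
have detE i : (weight_det a b i)%:~R =
    (a i * weight_sum b)%:R - (b i * weight_sum a)%:R :> R.
  by rewrite intrB !intrM !natrM.
under eq_bigr => i _ do rewrite detE mulrBl.
by rewrite sumrB e subrr.
Qed.

Lemma weight_det_pos_neg (R : realType) (N : nat) (a b : 'I_N -> nat) :
    toric_weights R a b ->
  (exists i, 0 < weight_det a b i) /\ (exists i, weight_det a b i < 0).
Proof.
move=> hW; have N0 := toric_weights_dim_gt0 hW.
have s0 := sum_weight_det a b; pose i0 := Ordinal N0.
have d0 i := weight_det_neq0 i hW.
split; apply: contrapT => h.
  have ge0 i : 0 <= - weight_det a b i.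
    by rewrite oppr_ge0 leNgt; apply/negP => hi; apply: h; exists i.
  have /eqP : \sum_i - weight_det a b i = 0 by rewrite sumrN s0 oppr0.
  rewrite psumr_eq0 // => /allP/(_ i0); rewrite mem_index_enum => /(_ isT) /=.
  by rewrite oppr_eq0 (negPf (d0 i0)).
have ge0 i : 0 <= weight_det a b i.
  by rewrite leNgt; apply/negP => hi; apply: h; exists i.
have /eqP := s0.
rewrite psumr_eq0 // => /allP/(_ i0); rewrite mem_index_enum => /(_ isT) /=.
by rewrite (negPf (d0 i0)).
Qed.

(** * The root in the cone *)

(** Common powers are split off. The truncated differences are the positive and negative parts of
    [weight_det], so the first remaining product involves only forms with positive determinant and
    the second only those with negative determinant. *)
Lemma root_poly_factor (R : realType) (N : nat) (a b : 'I_N -> nat) (x y : R) :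
  root_poly a b x y =
  \prod_i weight_form a b x y i ^+ minn (a i * weight_sum b) (b i * weight_sum a) *
  (\prod_i weight_form a b x y i ^+ (a i * weight_sum b - b i * weight_sum a) -
   \prod_i weight_form a b x y i ^+ (b i * weight_sum a - a i * weight_sum b)).
Proof.
rewrite mulrBr -!big_split /= /root_poly; congr (_ - _);
  apply: eq_bigr => i _; rewrite -exprD; congr (_ ^+ _); lia.
Qed.

(** Intermediate value theorem for the difference [P - Q] of the reduced products on the segment
    that the cone cuts out of the line a x + b y = 1. *)
Lemma exists_root_in_cone (R : realType) (N : nat) (a b : 'I_N -> nat) :
    toric_weights R a b ->
  exists mu nu : R,
    root_in_cone a b mu nu /\ (forall i, 0 < weight_form a b mu nu i).
Proof.
move=> hW; have N0 := toric_weights_dim_gt0 hW.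
have [nz ns _ _] := hW; have [nz' ns'] := toric_weights_swap hW.
have A0 : 0 < (weight_sum a)%:R :> R by rewrite ltr0n; exact: weight_sum_gt0 nz ns.
have B0 : 0 < (weight_sum b)%:R :> R by rewrite ltr0n; exact: weight_sum_gt0 nz' ns'.
set A : R := (weight_sum a)%:R in A0 *; set B : R := (weight_sum b)%:R in B0 *.
pose v i : R := (weight_det a b i)%:~R.
have vE i : v i = (a i)%:R * B - (b i)%:R * A by rewrite /v intrB !intrM.
(* Values of the forms at (1 / (2a), 1 / (2b)), an interior point of the cone on this line; along
   the direction (b, - a) form [i] changes at rate [v i]. *)
pose u0 i : R := (a i)%:R / (2 * A) + (b i)%:R / (2 * B).
have u0_gt0 i : 0 < u0 i.
  have [ai|ai] := posnP (a i).
    by rewrite /u0 ai mul0r add0r divr_gt0 ?mulr_gt0 // ltr0n lt0n; apply/eqP => bi; exact: (nz i).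
  apply: ltr_pwDl; first by rewrite divr_gt0 ?mulr_gt0 // ltr0n.
  by rewrite divr_ge0 // mulr_ge0 // ltW.
pose mu t := (2 * A)^-1 + t * B; pose nu t := (2 * B)^-1 - t * A.
have uE t i : weight_form a b (mu t) (nu t) i = u0 i + t * v i.
  by rewrite /weight_form /mu /nu /u0 vE; ring.
have v_sgn i : (0 < v i) = (0 < a i * weight_sum b - b i * weight_sum a)%N.
  by rewrite /v ltr0z /weight_det; lia.
have v_sgn' i : (v i < 0) = (0 < b i * weight_sum a - a i * weight_sum b)%N.
  by rewrite /v ltrz0 /weight_det; lia.
have [[ip vp] [im vm]] := weight_det_pos_neg hW.
have {}vp : 0 < v ip by rewrite /v ltr0z.
have {}vm : v im < 0 by rewrite /v ltrz0.
(* The segment ends where the first form vanishes on either side: at [tp] below 0, where [P] is 0,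
   and at [tm] above 0, where [Q] is 0. *)
have [jp vjp tpP] := @arg_maxP _ _ _ ip (fun i => 0 < v i) (fun i => - u0 i / v i) vp.
have [jm vjm tmP] := @arg_minP _ _ _ im (fun i => v i < 0) (fun i => - u0 i / v i) vm.
set tp := - u0 jp / v jp in tpP; set tm := - u0 jm / v jm in tmP.
have tp0 : tp < 0 by rewrite /tp mulNr oppr_lt0 divr_gt0.
have tm0 : 0 < tm by rewrite /tm mulNr -mulrN mulr_gt0 // oppr_gt0 invr_lt0.
pose P t : R := \prod_i weight_form a b (mu t) (nu t) i ^+ (a i * weight_sum b - b i * weight_sum a).
pose Q t : R := \prod_i weight_form a b (mu t) (nu t) i ^+ (b i * weight_sum a - a i * weight_sum b).
have u_ge0 t i : tp <= t <= tm -> 0 <= weight_form a b (mu t) (nu t) i.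
  move=> /andP[t1 t2]; rewrite uE.
  have [vi|vi|vi] := ltgtP (v i) 0.
  - have := tmP i vi; rewrite -/tm => h; have : t <= - u0 i / v i by exact: le_trans h.
    by rewrite ler_ndivlMr //; lra.
  - have := tpP i vi; rewrite -/tp => h; have : - u0 i / v i <= t by exact: le_trans t1.
    by rewrite ler_pdivrMr //; lra.
  - by rewrite vi mulr0 addr0 ltW.
have P_ge0 t : tp <= t <= tm -> 0 <= P t.
  by move=> ht; apply: prodr_ge0 => i _; rewrite exprn_ge0 ?u_ge0.
have Q_ge0 t : tp <= t <= tm -> 0 <= Q t.
  by move=> ht; apply: prodr_ge0 => i _; rewrite exprn_ge0 ?u_ge0.
have contu k : continuous (fun t => \prod_i weight_form a b (mu t) (nu t) i ^+ k i : R).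
  move=> t; apply: cvg_prodr => i; apply: cvg_exprn.
  under eq_fun do rewrite uE.
  rewrite uE; apply: cvgD; first exact: cvg_cst.
  by apply: cvgMl; exact: cvg_id.
have Pp : P tp = 0.
  apply/eqP; rewrite prodf_seq_eq0; apply/hasP; exists jp; rewrite ?mem_index_enum //=.
  by rewrite expf_eq0 -v_sgn vjp uE /tp (divfK (lt0r_neq0 vjp)) addrN eqxx.
have Qm : Q tm = 0.
  apply/eqP; rewrite prodf_seq_eq0; apply/hasP; exists jm; rewrite ?mem_index_enum //=.
  by rewrite expf_eq0 -v_sgn' vjm uE /tm (divfK (ltr0_neq0 vjm)) addrN eqxx.
have tpm : tp <= tm by lra.
have [||t ht PQ] := @IVT R (fun t => P t - Q t) tp tm 0 tpm.
- by apply: continuous_subspaceT => t; apply: cvgB; exact: contu.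
- have Qp := Q_ge0 tp ltac:(by rewrite lexx).
  have Pm := P_ge0 tm ltac:(by rewrite lexx andbT).
  by rewrite Pp Qm ge_min le_max; apply/andP; split; apply/orP; [left|right]; lra.
rewrite in_itv /= in ht.
(* A vanishing form with [v k > 0] needs [t < 0] and one with [v k < 0] needs
   [0 < t], but [P t = Q t = 0] would provide both. *)
have u_gt0 i : 0 < weight_form a b (mu t) (nu t) i.
  have zeroP k : 0 < v k -> weight_form a b (mu t) (nu t) k = 0 -> t < 0.
    rewrite uE => vk e; rewrite ltNge; apply/negP => t0.
    by have := u0_gt0 k; have := mulr_ge0 t0 (ltW vk); lra.
  have zeroN k : v k < 0 -> weight_form a b (mu t) (nu t) k = 0 -> 0 < t.
    rewrite uE => vk e; rewrite ltNge; apply/negP => t0.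
    by have := u0_gt0 k; have := mulr_le0 t0 (ltW vk); lra.
  rewrite lt_neqAle eq_sym u_ge0 // andbT; apply/eqP => ui0.
  have PQt : P t = Q t by lra.
  have [vi|vi|vi] := ltgtP (v i) 0.
  - have : P t == 0.
      rewrite PQt prodf_seq_eq0; apply/hasP; exists i; rewrite ?mem_index_enum //=.
      by rewrite expf_eq0 -v_sgn' vi ui0 eqxx.
    rewrite prodf_seq_eq0 => /hasP[k _ /=]; rewrite expf_eq0 -v_sgn => /andP[vk /eqP uk].
    by have := zeroP k vk uk; have := zeroN i vi ui0; lra.
  - have : Q t == 0.
      rewrite -PQt prodf_seq_eq0; apply/hasP; exists i; rewrite ?mem_index_enum //=.
      by rewrite expf_eq0 -v_sgn vi ui0 eqxx.
    rewrite prodf_seq_eq0 => /hasP[k _ /=]; rewrite expf_eq0 -v_sgn' => /andP[vk /eqP uk].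
    by have := zeroN k vk uk; have := zeroP i vi ui0; lra.
  - by have := weight_det_neq0 i hW; rewrite -(intr_eq0 R) -/(v i) vi eqxx.
exists (mu t), (nu t); split=> //; split.
- move=> [m0 n0]; have := u_gt0 ip.
  by rewrite /weight_form m0 n0 !mulr0 addr0 ltxx.
- by rewrite root_poly_factor -/(P t) -/(Q t) PQ mulr0.
- by move=> i; exact/ltW.
Qed.

Lemma sum_root_p (R : realType) (N : nat) (a b : 'I_N -> nat) (x y : R) :
  0 < \sum_i weight_form a b x y i -> \sum_i root_p a b x y i = 1.
Proof.
by move=> U0; under eq_bigr do rewrite root_pE; rewrite -mulr_suml divff // gt_eqF.
Qed.

Lemma root_p_ln (R : realType) (N : nat) (a b : 'I_N -> nat) (x y : R) :
    (forall i, 0 < weight_form a b x y i) -> 0 < \sum_i weight_form a b x y i ->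
    root_poly a b x y = 0 ->
  \sum_i (weight_det a b i)%:~R * ln (root_p a b x y i) = 0.
Proof.
move=> u0 U0 r0.
under eq_bigr do rewrite root_pE ln_div ?posrE // mulrBr.
rewrite sumrB root_poly_ln // -mulr_suml -[\sum_i _](raddf_sum (intr : int -> R)).
by rewrite sum_weight_det mul0r subrr.
Qed.

(** Normalised to a x + b y = 1, the two points differ by t (b, - a), and the vectors p, p' by t
    times the determinants. The sum of (p'_i - p_i)(ln p'_i - ln p_i) is then 0 by [root_p_ln],
    while every term is nonnegative; a zero term forces t = 0. *)
Lemma root_in_cone_unique (R : realType) (N : nat) (a b : 'I_N -> nat)
    (mu nu mu' nu' : R) :
    toric_weights R a b ->
    root_in_cone a b mu nu -> (forall i, 0 < weight_form a b mu nu i) ->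
    root_in_cone a b mu' nu' -> (forall i, 0 < weight_form a b mu' nu' i) ->
  same_point mu nu mu' nu'.
Proof.
move=> hW [_ r _] u0 [_ r' _] u0'; have N0 := toric_weights_dim_gt0 hW.
have [nz ns _ _] := hW; have [nz' ns'] := toric_weights_swap hW.
have A0 : 0 < (weight_sum a)%:R :> R by rewrite ltr0n; exact: weight_sum_gt0 nz ns.
have B0 : 0 < (weight_sum b)%:R :> R by rewrite ltr0n; exact: weight_sum_gt0 nz' ns'.
pose i0 := Ordinal N0.
have U_gt0 (x y : R) : (forall i, 0 < weight_form a b x y i) -> 0 < \sum_i weight_form a b x y i.
  by move=> h; rewrite (bigD1 i0) //= ltr_pwDl //; apply: sumr_ge0 => i _; exact: ltW.
have U0 := U_gt0 _ _ u0; have U0' := U_gt0 _ _ u0'.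
have e := root_p_ln u0 U0 r; have e' := root_p_ln u0' U0' r'.
set U := \sum_i weight_form a b mu nu i in U0.
set U' := \sum_i weight_form a b mu' nu' i in U0'.
have UE : U = (weight_sum a)%:R * mu + (weight_sum b)%:R * nu by exact: sum_weight_form.
have UE' : U' = (weight_sum a)%:R * mu' + (weight_sum b)%:R * nu' by exact: sum_weight_form.
pose t := (mu' / U' - mu / U) / (weight_sum b)%:R.
have Un0 : U != 0 by rewrite gt_eqF.
have Un0' : U' != 0 by rewrite gt_eqF.
have Bn0 : (weight_sum b)%:R != 0 :> R by rewrite gt_eqF.
have nu_t : nu' / U' - nu / U = - t * (weight_sum a)%:R.
  have eU : (weight_sum a)%:R * (mu / U) + (weight_sum b)%:R * (nu / U) = 1.
    by rewrite !mulrA -mulrDl -UE divff.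
  have eU' : (weight_sum a)%:R * (mu' / U') + (weight_sum b)%:R * (nu' / U') = 1.
    by rewrite !mulrA -mulrDl -UE' divff.
  apply: (mulfI Bn0).
  have -> : (weight_sum b)%:R * (- t * (weight_sum a)%:R) =
      - ((weight_sum a)%:R * (mu' / U' - mu / U)).
    rewrite /t; move: (_ - _) (weight_sum a)%:R (weight_sum b)%:R Bn0 => X A' B' h.
    by field.
  lra.
have pp i : root_p a b mu' nu' i - root_p a b mu nu i = t * (weight_det a b i)%:~R.
  have pE (x y z : R) : weight_form a b x y i / z = (a i)%:R * (x / z) + (b i)%:R * (y / z).
    by rewrite /weight_form; ring.
  rewrite !root_pE -/U -/U' !pE intrB !intrM.
  have -> : mu' / U' = mu / U + t * (weight_sum b)%:R by rewrite /t divfK //; ring.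
  have -> : nu' / U' = nu / U - t * (weight_sum a)%:R by lra.
  by rewrite -!pmulrn; ring.
have p0 i : 0 < root_p a b mu nu i by rewrite root_pE divr_gt0.
have p0' i : 0 < root_p a b mu' nu' i by rewrite root_pE divr_gt0.
have term i : 0 <= (t * (weight_det a b i)%:~R) *
    (ln (root_p a b mu' nu' i) - ln (root_p a b mu nu i)).
  rewrite -pp; have [h|h] := leP (root_p a b mu nu i) (root_p a b mu' nu' i).
    by rewrite mulr_ge0 ?subr_ge0 // ler_ln ?posrE.
  by rewrite mulr_le0 ?subr_le0 ?ler_ln ?posrE // ltW.
have : \sum_i (t * (weight_det a b i)%:~R) *
    (ln (root_p a b mu' nu' i) - ln (root_p a b mu nu i)) = 0.
  under eq_bigr do rewrite -mulrA mulrBr.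
  by rewrite -mulr_sumr sumrB e e' subrr mulr0.
move=> /eqP; rewrite psumr_eq0 // => /allP/(_ i0); rewrite mem_index_enum => /(_ isT).
rewrite /= mulf_eq0 => h.
have t0 : t = 0.
  have d0 : (weight_det a b i0)%:~R != 0 :> R by rewrite intr_eq0 (weight_det_neq0 _ hW).
  case/orP : h; first by rewrite mulf_eq0 (negPf d0) orbF => /eqP.
  rewrite subr_eq0 => /eqP/ln_inj; rewrite !posrE => /(_ (p0' _) (p0 _)) epp.
  by have := pp i0; rewrite epp subrr => /esym/eqP; rewrite mulf_eq0 (negPf d0) orbF => /eqP.
have m_eq : mu' / U' = mu / U.
  by move/eqP: t0; rewrite /t mulf_eq0 invr_eq0 (negPf Bn0) orbF subr_eq0 => /eqP.
have n_eq : nu' / U' = nu / U by move: nu_t; rewrite t0; lra.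
have -> : mu' = mu / U * U' by rewrite -m_eq divfK.
have -> : nu' = nu / U * U' by rewrite -n_eq divfK.
by rewrite /same_point; ring.
Qed.

(** The two columns confine the cone to the first quadrant. On mu = 0 the form of column [j0] kills
    the first product but the second is nonzero, and conversely on nu = 0; inside the quadrant all
    forms are positive. *)
Lemma root_in_cone_interior (R : realType) (N : nat) (a b : 'I_N -> nat)
    (mu nu : R) :
    toric_weights R a b -> (exists i, a i = 0%N) -> (exists j, b j = 0%N) ->
    root_in_cone a b mu nu ->
  forall i, 0 < weight_form a b mu nu i.
Proof.
move=> hW [i0 ai0] [j0 bj0] [nz0 r cone]; have N0 := toric_weights_dim_gt0 hW.
have [nz ns _ _] := hW; have [nz' ns'] := toric_weights_swap hW.
have A0 := weight_sum_gt0 N0 nz ns; have B0 := weight_sum_gt0 N0 nz' ns'.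
have bi0 : (0 < b i0)%N by rewrite lt0n; apply/eqP => ?; exact: (nz i0).
have aj0 : (0 < a j0)%N by rewrite lt0n; apply/eqP => ?; exact: (nz j0).
have nu0 : 0 <= nu.
  by have := cone i0; rewrite /= /weight_form ai0 mul0r add0r pmulr_rge0 // ltr0n.
have mu0 : 0 <= mu.
  by have := cone j0; rewrite /= /weight_form bj0 mul0r addr0 pmulr_rge0 // ltr0n.
have mu_neq0 : mu != 0.
  apply/eqP => m0.
  have n0 : 0 < nu.
    rewrite lt_neqAle nu0 andbT eq_sym; apply/eqP => n0.
    by apply: nz0; rewrite m0 n0.
  move: r; rewrite /root_poly (bigD1 j0) //= {1}/weight_form m0 bj0 mulr0 mul0r addr0.
  rewrite expr0n muln_eq0 !gtn_eqF //= mul0r sub0r => /eqP; rewrite oppr_eq0.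
  rewrite prodf_seq_eq0 => /hasP[k _ /=].
  rewrite expf_eq0 muln_gt0 A0 andbT => /andP[bk].
  by rewrite /weight_form mulr0 add0r mulf_eq0 pnatr_eq0 gtn_eqF //= gt_eqF.
have nu_neq0 : nu != 0.
  apply/eqP => n0.
  have m0 : 0 < mu by rewrite lt_neqAle mu0 andbT eq_sym.
  move: r; rewrite /root_poly [X in _ - X](bigD1 i0) //= {2}/weight_form n0 ai0 mulr0 mul0r addr0.
  rewrite expr0n muln_eq0 !gtn_eqF //= mul0r subr0 => /eqP.
  rewrite prodf_seq_eq0 => /hasP[k _ /=].
  rewrite expf_eq0 muln_gt0 B0 andbT => /andP[ak].
  by rewrite /weight_form mulr0 addr0 mulf_eq0 pnatr_eq0 gtn_eqF //= gt_eqF.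
have mu_gt0 : 0 < mu by rewrite lt_neqAle mu0 andbT eq_sym.
have nu_gt0 : 0 < nu by rewrite lt_neqAle nu0 andbT eq_sym.
move=> i; rewrite /weight_form; have [ai|ai] := posnP (a i).
  rewrite ai mul0r add0r mulr_gt0 // ltr0n lt0n; apply/eqP => bi; exact: (nz i).
by rewrite ltr_pwDl ?mulr_gt0 ?ltr0n // mulr_ge0.
Qed.

(** * Lattice points on the line a x + b y = d *)

Lemma bezout_weight_sum (N : nat) (a b : 'I_N -> nat) :
  exists k l : int, (weight_sum a)%:Z * k + (weight_sum b)%:Z * l =
    (gcdn (weight_sum a) (weight_sum b))%:Z.
Proof.
have [k [l e]] := Bezoutz (weight_sum a) (weight_sum b).
by exists k, l; rewrite mulrC [_ * l]mulrC e.
Qed.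

(* [weight_step a b] is the increment of the arguments of the factorials along
   the primitive lattice vector (b, - a) / gcd(a, b). *)
Definition weight_step (N : nat) (a b : 'I_N -> nat) (i : 'I_N) : int :=
  let l := gcdn (weight_sum a) (weight_sum b) in
  (a i)%:Z * (weight_sum b %/ l)%N%:Z - (b i)%:Z * (weight_sum a %/ l)%N%:Z.

Lemma weight_stepE (N : nat) (a b : 'I_N -> nat) (i : 'I_N) :
  weight_det a b i = (gcdn (weight_sum a) (weight_sum b))%:Z * weight_step a b i.
Proof.
rewrite /weight_det /weight_step.
rewrite -[in X in X - _](divnK (dvdn_gcdr (weight_sum a) (weight_sum b))).
rewrite -[in X in _ - X](divnK (dvdn_gcdl (weight_sum a) (weight_sum b))).
rewrite !PoszM; ring.
Qed.

Definition line_base (N : nat) (a b : 'I_N -> nat) (k l : int) (i : 'I_N) : int :=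
  (a i)%:Z * k + (b i)%:Z * l.

(** The map [h] steps along the primitive vector (b, - a) / gcd(a, b); it reaches every lattice
    point of the line because [A'] and [B'] are coprime. *)
Lemma period_coef_line (R : realType) (N : nat) (a b : 'I_N -> nat) (d : nat)
    (k0 l0 : int) :
    (0 < weight_sum a)%N -> (0 < weight_sum b)%N ->
    (weight_sum a)%:Z * k0 + (weight_sum b)%:Z * l0 = d ->
  period_coef R a b d =
  \sum_(j \in line_points (line_base a b k0 l0) (weight_step a b))
    line_multinomial R d (line_base a b k0 l0) (weight_step a b) j.
Proof.
move=> A0 B0 d_kl.
set l := gcdn (weight_sum a) (weight_sum b).
have l0' : (0 < l)%N by rewrite gcdn_gt0 A0.
pose A' := (weight_sum a %/ l)%N; pose B' := (weight_sum b %/ l)%N.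
have AE : (weight_sum a)%:Z = A'%:Z * l by rewrite -PoszM divnK // dvdn_gcdl.
have BE : (weight_sum b)%:Z = B'%:Z * l by rewrite -PoszM divnK // dvdn_gcdr.
have B'0 : (0 < B')%N by rewrite divn_gt0 // dvdn_leq // dvdn_gcdr.
have lz : l%:Z != 0 by rewrite eqz_nat -lt0n.
have Bz : B'%:Z != 0 by rewrite eqz_nat -lt0n.
pose h (j : int) : int * int := (k0 + j * B', l0 - j * A').
have cntE j i : (a i)%:Z * (h j).1 + (b i)%:Z * (h j).2 =
    line_count (line_base a b k0 l0) (weight_step a b) j i.
  by rewrite /line_count /line_base /weight_step -/l -/A' -/B' /h /=; ring.
have formE (k m : int) i : weight_form a b k%:~R m%:~R i =
    ((a i)%:Z * k + (b i)%:Z * m)%:~R :> R.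
  by rewrite intrD !intrM.
have dE j : (weight_sum a)%:Z * (h j).1 + (weight_sum b)%:Z * (h j).2 = d.
  by rewrite -d_kl /h /= AE BE; ring.
rewrite /period_coef (reindex_fsbig h (line_points (line_base a b k0 l0) (weight_step a b))).
  apply: eq_fsbigr => j _; rewrite /multinomial_term /line_multinomial dE absz_nat.
  by congr (_ / _); apply: eq_bigr => i _; rewrite cntE.
split => [j Jj|i j _ _ []|[k m] [cone e]].
- by split; [move=> i /=; rewrite formE cntE ler0z; exact: Jj|exact: dE].
- by move=> /addrI/(mulIf Bz).
(* The difference of two lattice points is j (B', - A'); pairing it with the Bezout coefficients, A'
   u + B' v = 1, recovers [j] as the witness below. *)
- have [u [v uv]] := bezout_weight_sum a b.
  have uv' : A'%:Z * u + B'%:Z * v = 1.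
    by apply: (mulIf lz); rewrite mul1r -[RHS]uv AE BE; ring.
  have perp : A'%:Z * (k - k0) + B'%:Z * (m - l0) = 0.
    apply: (mulIf lz); rewrite mul0r -[RHS](subrr d%:Z) -{1}e -d_kl /= AE BE; ring.
  have kE : k0 + ((k - k0) * v - (m - l0) * u) * B' = k.
    have -> : k0 + ((k - k0) * v - (m - l0) * u) * B' =
       k0 + (k - k0) * (A'%:Z * u + B'%:Z * v) - u * (A'%:Z * (k - k0) + B'%:Z * (m - l0)) by ring.
    by rewrite uv' perp; ring.
  have mE : l0 - ((k - k0) * v - (m - l0) * u) * A' = m.
    have -> : l0 - ((k - k0) * v - (m - l0) * u) * A' =
       l0 + (m - l0) * (A'%:Z * u + B'%:Z * v) - v * (A'%:Z * (k - k0) + B'%:Z * (m - l0)) by ring.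
    by rewrite uv' perp; ring.
  have hE : h ((k - k0) * v - (m - l0) * u) = (k, m) by rewrite /h kE mE.
  exists ((k - k0) * v - (m - l0) * u) => // i.
  by rewrite -cntE hE /= -(ler0z R) -formE; exact: cone.
Qed.

Lemma period_coef_neq0_dvd (R : realType) (N : nat) (a b : 'I_N -> nat) (d : nat) :
  period_coef R a b d != 0 -> (gcdn (weight_sum a) (weight_sum b) %| d)%N.
Proof.
apply: contra_neqT => ndvd; apply: fsbig1 => -[k m] [_ /= e].
case/negP : ndvd; rewrite -[d]absz_nat -e.
by rewrite -[gcdn _ _]/(absz (Posz (gcdn _ _))) -dvdzE rpredD // dvdz_mulr //
  dvdzE /= ?dvdn_gcdl ?dvdn_gcdr.
Qed.

(** * Asymptotics of the period coefficients *)

Lemma ln_period_coef_cvg (R : realType) (N : nat) (a b : 'I_N -> nat) (mu nu : R) :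
    toric_weights R a b ->
    root_in_cone a b mu nu -> (forall i, 0 < weight_form a b mu nu i) ->
  (ln (period_coef R a b d)
    - (growthA a b mu nu * d%:R - (dimX N)%:R / 2 * ln d%:R
       + growthB a b mu nu))
    @[d --> within [set d : nat | period_coef R a b d != 0] \oo] --> (0 : R).
Proof.
move=> hW [_ r _] u0; have N0 := toric_weights_dim_gt0 hW.
have [nz ns _ _] := hW; have [nz' ns'] := toric_weights_swap hW.
have A0 := weight_sum_gt0 N0 nz ns; have B0 := weight_sum_gt0 N0 nz' ns'.
have A0R : 0 < (weight_sum a)%:R :> R by rewrite ltr0n.
have B0R : 0 < (weight_sum b)%:R :> R by rewrite ltr0n.
set l := gcdn (weight_sum a) (weight_sum b).
have l_gt0 : (0 < l)%N by rewrite gcdn_gt0 A0.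
have lR : 0 < l%:R :> R by rewrite ltr0n.
(* Determinants of both signs need two columns, so the subtraction in [dimX] is not truncated. *)
have N2 : (2 <= N)%N.
  have [[i ip] [k km]] := weight_det_pos_neg hW.
  case: N a b i k ip km {hW r u0 nz ns nz' ns' A0 B0 A0R B0R l l_gt0 lR} N0 =>
     [//|[|//]] a b i k ip km _.
  by move: ip; rewrite (ord1 i) -(ord1 k) => /(lt_trans km); rewrite ltxx.
pose U := \sum_i weight_form a b mu nu i.
have U0 : 0 < U.
  by rewrite /U (bigD1 (Ordinal N0)) //= ltr_pwDl //; apply: sumr_ge0 => i _; exact: ltW.
pose p := root_p a b mu nu.
have p0 i : 0 < p i by rewrite /p root_pE divr_gt0.
have p1 : \sum_i p i = 1 by exact: sum_root_p.
pose w := weight_step a b.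
have vw i : (weight_det a b i)%:~R = l%:R * (w i)%:~R :> R by rewrite weight_stepE intrM.
have w0 : \sum_i w i = 0.
  have := sum_weight_det a b; under eq_bigr do rewrite weight_stepE.
  by rewrite -mulr_sumr => /eqP; rewrite mulf_eq0 eqz_nat gtn_eqF //= => /eqP.
have wn0 : exists i, w i != 0.
  exists (Ordinal N0); have := weight_det_neq0 (Ordinal N0) hW.
  by rewrite weight_stepE mulf_eq0 negb_or => /andP[].
have wp : \sum_i (w i)%:~R * ln (p i) = 0.
  have := root_p_ln u0 U0 r; under eq_bigr do rewrite vw -mulrA.
  by rewrite -mulr_sumr => /eqP; rewrite mulf_eq0 gt_eqF //= => /eqP.
have [k0 [l0 kl]] := bezout_weight_sum a b; rewrite -/l in kl.
(* The positive multiples of the gcd; scaling the Bezout pair gives a lattice point on each line. *)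
pose D m := (l * m.+1)%N.
pose n0 m := line_base a b (k0 * m.+1) (l0 * m.+1).
have Doo : D @ \oo --> \oo.
  apply/cvgnyPge => M; exists M => // m /= Mm.
  by rewrite /D (leq_trans Mm) // (leq_trans (leqnSn m)) // leq_pmull.
have D0 m : (0 < D m)%N by rewrite muln_gt0 l_gt0.
(* The index, in steps of (b, - a) / l, at which the line meets the ray through (mu, nu), read off
   from the first coordinate. *)
pose c m : R := m.+1%:R * (l%:R * (mu / U) - k0%:~R) / (weight_sum b)%:R * l%:R.
have klR : (weight_sum a)%:R * k0%:~R + (weight_sum b)%:R * l0%:~R = l%:R :> R.
  by have := congr1 (intr : int -> R) kl; rewrite /= intrD !intrM.
have UE : (weight_sum a)%:R * (mu / U) + (weight_sum b)%:R * (nu / U) = 1.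
  by rewrite !mulrA -mulrDl -sum_weight_form divff // gt_eqF.
have n0E m i : (n0 m i)%:~R = p i * (D m)%:R - c m * (w i)%:~R.
  have -> : p i = (a i)%:R * (mu / U) + (b i)%:R * (nu / U).
    by rewrite /p root_pE /weight_form -/U; ring.
  have -> : c m * (w i)%:~R = m.+1%:R * (l%:R * (mu / U) - k0%:~R) / (weight_sum b)%:R *
      (weight_det a b i)%:~R.
    by rewrite vw /c; ring.
  rewrite /n0 /line_base /D natrM intrD !intrM /weight_det intrB !intrM.
  move: UE klR; rewrite -!pmulrn.
  move: (mu / U) (nu / U) (weight_sum a)%:R (weight_sum b)%:R B0R (l%:R : R) => x y A B B0' L e1 e2.
  have -> : (l0%:~R : R) = (L - A * k0%:~R) / B by rewrite -e2; field; rewrite gt_eqF.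
  have -> : y = (1 - A * x) / B by rewrite -e1; field; rewrite gt_eqF.
  by field; rewrite gt_eqF.
have lim := cvg_ln_line_sum (@stirling R) p0 p1 w0 wn0 wp Doo D0 n0E.
have coefE m : \sum_(j \in line_points (n0 m) w) line_multinomial R (D m) (n0 m) w j =
    period_coef R a b (D m).
  rewrite (period_coef_line R A0 B0 (k0 := k0 * m.+1) (l0 := l0 * m.+1)) //.
  by rewrite !mulrA -mulrDl kl -PoszM.
pose F d : R := ln (period_coef R a b d)
    - (growthA a b mu nu * d%:R - (dimX N)%:R / 2 * ln d%:R + growthB a b mu nu).
have dimE : (dimX N)%:R = N%:R - 2 :> R by rewrite /dimX natrB.
have SE : \sum_i ((a i)%:R * (weight_sum b)%:R - (b i)%:R * (weight_sum a)%:R) ^+ 2 /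
      (l%:R ^+ 2 * root_p a b mu nu i) = \sum_i (w i)%:~R ^+ 2 / p i.
  apply: eq_bigr => i _.
  have -> : (a i)%:R * (weight_sum b)%:R - (b i)%:R * (weight_sum a)%:R = l%:R * (w i)%:~R :> R.
    by rewrite -vw intrB !intrM.
  by rewrite -/(p i); field; rewrite !gt_eqF.
have FD : F (D m) @[m --> \oo] --> (0 : R).
  (* The terms in ln (2 pi) combine to the coefficient -(N - 2) / 2. *)
  have e : growthB a b mu nu =
      (1 - N%:R) * (ln (2 * pi) / 2) - (\sum_i ln (p i)) / 2 + ln (2 * pi) / 2
      - ln (\sum_i (w i)%:~R ^+ 2 / p i) / 2.
    by rewrite /growthB -/l SE dimE -/p; field.
  have FE m : F (D m) =
      ln (\sum_(j \in line_points (n0 m) w) line_multinomial R (D m) (n0 m) w j)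
      - (- (\sum_i p i * ln (p i)) * (D m)%:R - (N%:R - 2) / 2 * ln (D m)%:R)
      - growthB a b mu nu.
    by rewrite /F coefE /growthA dimE -/p; ring.
  rewrite -[X in _ --> X](subrr (growthB a b mu nu)).
  under eq_fun do rewrite FE.
  by apply: cvgB; [rewrite e|exact: cvg_cst].
(* The limit along the multiples of [l] suffices: every [d] with nonzero coefficient is one, and d
   >= l (M + 1) excludes 0 and makes its index at least [M]. *)
move=> V /FD [M _ MV]; exists (l * M.+1)%N => // d /= Md dn0.
have [q dE] : exists q, d = (q * l)%N by apply/dvdnP; exact: period_coef_neq0_dvd dn0.
case: q dE => [|q] dE; first by move: Md; rewrite dE mul0n leqNgt muln_gt0 l_gt0.
have qM : (M <= q)%N by move: Md; rewrite dE [(q.+1 * l)%N]mulnC leq_pmul2l.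
have -> : d = D q by rewrite dE mulnC.
exact: MV.
Qed.

(** Strict positivity of the forms selects the root: on a boundary ray of the cone where a form with
    both weights positive vanishes, both products are 0. *)
Theorem theorem6 (R : realType) (N : nat) (a b : 'I_N -> nat)
    (hW : toric_weights R a b) :
  [/\
    exists mu nu : R,
      root_in_cone a b mu nu /\ (forall i, 0 < weight_form a b mu nu i),
    forall mu nu mu' nu' : R,
      root_in_cone a b mu nu -> (forall i, 0 < weight_form a b mu nu i) ->
      root_in_cone a b mu' nu' -> (forall i, 0 < weight_form a b mu' nu' i) ->
      same_point mu nu mu' nu',
    (* if some column has a_i = 0 and some column has b_j = 0, then every root
       with a_i mu + b_i nu >= 0 for all i is of the above kind *)
    (exists i, a i = 0%N) -> (exists j, b j = 0%N) ->
      forall mu nu : R,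
      root_in_cone a b mu nu -> forall i, 0 < weight_form a b mu nu i
  & forall mu nu : R,
      root_in_cone a b mu nu -> (forall i, 0 < weight_form a b mu nu i) ->
      (ln (period_coef R a b d)
        - (growthA a b mu nu * d%:R - (dimX N)%:R / 2 * ln d%:R
           + growthB a b mu nu))
        @[d --> within [set d : nat | period_coef R a b d != 0] \oo] --> (0 : R)
  ].
Proof.
split; [exact: exists_root_in_cone | | | ].
- by move=> mu nu mu' nu'; exact: root_in_cone_unique.
- by move=> ha hb mu nu; exact: root_in_cone_interior.
- by move=> mu nu; exact: ln_period_coef_cvg.
Qed.
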